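(* Consider the binary logistic model with i.i.d. sample $(Y_i,X_i)_{i=1}^n$ and the fully connected deep neural networks $f_\theta$, $\theta\in\Theta_{L,D}$, with activation function $\phi$, depth $L$ and width $D$, as described in the context, with logistic risk $R$. Let $\beta>0$ and take $L\asymp[n/\log(n)]^{\frac{d}{4(\beta+d)}}$, $D\asymp[n/\log(n)]^{\frac{d}{4(\beta+d)}}$. Assume: (i) $\phi:\mathbb{R}\to\mathbb{R}$ is $1$-Lipschitz and satisfies $|\phi(x)|\le|x|$ for all $x\in\mathbb{R}$; for constants $C\ge1$ and $B\ge1$, $\|f_0\|_\infty\le C$, $\|f_\theta\|_\infty\le C$ for all $\theta\in\Theta_{L,D}$, and all coefficients of $\theta\in\Theta_{L,D}$ are bounded by $B$ in absolute value; (ii) there is a constant $K>0$ such that for every $\theta\in\Theta_{L,D}$, $$\mathbb{E}\{[\ell(Y_i,f_\theta(X_i))-\ell(Y_i,f_0(X_i))]^2\}\le K\,[R(\theta)-R(f_0)].$$ Take $\lambda=n/\max(2K,C)$ and let $\psi_n:=\left[\frac{\log(n)}{n}\right]^{\frac{\beta}{\beta+d}}$. Then there is a constant $\mathcal{H}>0$ depending only on $B,C,K$ such that $$\mathbb{E}\,\mathbb{E}_{\theta\sim\hat\rho_\lambda}[R(\theta)]-R(f_0)\le\min_{\theta\in\Theta_{L,D}}2\,[R(\theta)-R(f_0)]+\mathcal{H}\,\psi_n,$$ and, for any $\delta\in(0,1)$, $$\mathbb{P}\Big\{\mathbb{E}_{\theta\sim\hat\rho_\lambda}[R(\theta)]-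R(f_0)\le\min_{\theta\in\Theta_{L,D}}3\,[R(\theta)-R(f_0)]+\mathcal{H}\,\psi_n+\mathcal{H}\,\frac{\log(2/\delta)}{n}\Big\}\ge1-\delta.$$
   Context: Logistic model: $(Y_i,X_i)\in\{-1,1\}\times[0,1]^d$, $i=1,\dots,n$ ($n\ge2$), are i.i.d. from a distribution $P$ such that $P(Y_i=1\mid X_i=x)=\eta(x)=(1+e^{-f_0(x)})^{-1}$ for all $x\in[0,1]^d$, where $f_0:[0,1]^d\to\mathbb{R}$ is unknown. Networks: $f_\theta:\mathbb{R}^d\to\mathbb{R}$ is defined by $x^{(0)}=x$, $x^{(\ell)}=\phi(W_\ell x^{(\ell-1)}+b_\ell)$ for $\ell=1,\dots,L-1$, and $f_\theta(x)=\phi(W_Lx^{(L-1)}+b_L)$, with $\phi$ applied componentwise, $W_\ell\in\mathbb{R}^{D_\ell\times D_{\ell-1}}$, $b_\ell\in\mathbb{R}^{D_\ell}$, $D_0=d$, $D_L=1$, $D_\ell=D$ for $1\le\ell\le L-1$; the depth satisfies $L\ge3$ and the width $D\ge d$. The parameter is $\theta=\{(W_\ell,b_\ell)\}_{\ell=1}^L$, also viewed as a vector of coefficients. $\Theta_{L,D}$ is the set of all such parameters, whose coefficients are all bounded in absolute value by $B$. For a function $f$ on $[0,1]^d$, $\|f\|_\infty=\sup_{t\in[0,1]^d}|f(t)|$. Loss and risks: $\ell(y,u)=\log(1+e^{-yu})$ for $(y,u)\in\{-1,1\}\times\mathbb{R}$; $R(\theta)=\mathbb{E}[\ell(Y_1,f_\theta(X_1))]$,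 $R(f_0)=\mathbb{E}[\ell(Y_1,f_0(X_1))]$, and $r_n(\theta)=\frac1n\sum_{i=1}^n\ell(Y_i,f_\theta(X_i))$. Prior and Gibbs posterior: the prior $\pi$ makes the coefficients of $\theta$ independent $\mathcal{N}(0,1)$. For $\lambda>0$, $\hat\rho_\lambda$ is the probability measure on $\Theta_{L,D}$ with density proportional to $\exp[-\lambda r_n(\theta)]\,\pi(\theta)$. $\mathbb{E}_{\theta\sim\hat\rho_\lambda}$ is the expectation over $\theta$ given the sample; $\mathbb{E}$ and $\mathbb{P}$ refer to the sample. $a_n\asymp b_n$ means $c\,b_n\le a_n\le c'\,b_n$ for fixed constants $c,c'>0$. The quantities $d$, $\beta$ and the constants implicit in $\asymp$ are regarded as fixed. *)

(* Defs.v *)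
From HB Require Import structures.
From mathcomp Require Import all_boot all_order all_algebra.
From mathcomp Require Import all_classical all_reals all_analysis.
Set Implicit Arguments.
Unset Strict Implicit.
Unset Printing Implicit Defensive.
Import Order.TTheory GRing.Theory Num.Theory.
Import numFieldNormedType.Exports.
Local Open Scope classical_set_scope.
Local Open Scope ring_scope.

Section ProbabilityNotions.
Context {R : realType} {d1 d2 : measure_display}.
Context {W : measurableType d1} {S : measurableType d2}.

Definition mutually_independent (P : probability W R) (I : finType)
    (Z : I -> W -> S) : Prop :=
  forall (J : {set I}) (A : I -> set S), (forall i, measurable (A i)) ->
    P (\bigcap_(i in [set i | i \in J]) Z i @^-1` A i) =
    (\prod_(i in J) P (Z i @^-1` A i))%E.

Definition identically_distributed (P : probability W R) (I : finType)
    (Z : I -> W -> S) : Prop :=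
  forall (i j : I) (A : set S), measurable A ->
    P (Z i @^-1` A) = P (Z j @^-1` A).

End ProbabilityNotions.

Definition is_min {R : realType} (A : set (\bar R)) (m : \bar R) : Prop :=
  A m /\ lbound A m.

Definition unit_cube (R : realType) (d : nat) : set (d.-tuple R) :=
  [set x | forall i, 0 <= tnth x i <= 1].
Arguments unit_cube : clear implicits.

Definition sup_norm {R : realType} {d : nat} (f : d.-tuple R -> R) : \bar R :=
  ereal_sup [set `|f t|%:E | t in unit_cube R d].

(* The parameters of a network with layers 1, ..., L are stored as one real
   vector, indexed by the finite type [coef d L D].  Layers are numbered from 0:
   the layer [l : 'I_L] below carries W_(l+1) and b_(l+1), and maps
   x^(l) : 'cV_(width l) to x^(l+1) : 'cV_(width l.+1). *)
Section Networks.
Context {R : realType} (d L D : nat).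

Definition width (l : nat) : nat :=
  if l is 0 then d else if l == L then 1%N else D.

Lemma width_last : (0 < L)%N -> width L = 1%N.
Proof. by rewrite /width; case: L => // k _; rewrite eqxx. Qed.

Definition layer_coef (l : 'I_L) : finType :=
  ('I_(width l.+1) * 'I_(width l) + 'I_(width l.+1))%type.

Definition coef : finType := {l : 'I_L & layer_coef l}.

Definition param : Type := (#|coef|).-tuple R.

Definition coefficient (theta : param) (c : coef) : R :=
  tnth theta (enum_rank c).

Definition weight (theta : param) (l : 'I_L) :
    'M[R]_(width l.+1, width l) :=
  \matrix_(i, j) coefficient theta (Tagged layer_coef (inl (i, j))).

Definition bias (theta : param) (l : 'I_L) : 'cV[R]_(width l.+1) :=
  \col_i coefficient theta (Tagged layer_coef (inr i)).

Fixpoint activation (phi : R -> R) (theta : param) (x : d.-tuple R) (l : nat) :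
    (l <= L)%N -> 'cV[R]_(width l) :=
  match l with
  | 0 => fun _ => \col_i tnth x i
  | k.+1 => fun h =>
      map_mx phi (weight theta (Ordinal h) *m activation phi theta x (ltnW h)
                  + bias theta (Ordinal h))
  end.

Definition network (hL : (0 < L)%N) (phi : R -> R) (theta : param)
    (x : d.-tuple R) : R :=
  activation phi theta x (leqnn L) (cast_ord (esym (width_last hL)) ord0) ord0.

Definition bounded_params (B : R) : set param :=
  [set theta | forall c, `|coefficient theta c| <= B].

End Networks.

Arguments param : clear implicits.
Arguments bounded_params : clear implicits.

Definition loss {R : realType} (y u : R) : R := ln (1 + expR (- (y * u))).

Definition eta {R : realType} {d : nat} (f0 : d.-tuple R -> R)
    (x : d.-tuple R) : R := (1 + expR (- f0 x))^-1.

Section Sample.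
Context {R : realType} {dW : measure_display} {W : measurableType dW}.
Context (P : probability W R) (d n : nat).
Context (Y : 'I_n -> W -> R) (X : 'I_n -> W -> d.-tuple R).

(* [logistic_conditional] is the defining property of the conditional
   probability: eta(X_i) is a version of P(Y_i = 1 | X_i). *)
Record logistic_sample (f0 : d.-tuple R -> R) : Prop := LogisticSample {
  logistic_measurable_label : forall i, measurable_fun setT (Y i);
  logistic_measurable_input : forall i, measurable_fun setT (X i);
  logistic_label : forall i w, Y i w = -1 \/ Y i w = 1;
  logistic_input : forall i w, X i w \in unit_cube R d;
  logistic_independent : mutually_independent P (fun i w => (Y i w, X i w));
  logistic_identical : identically_distributed P (fun i w => (Y i w, X i w));
  logistic_measurable_f0 : measurable_fun (unit_cube R d) f0;
  logistic_conditional : forall i (A : set (d.-tuple R)), measurable A ->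
    P [set w | Y i w = 1 /\ A (X i w)] =
    (\int[P]_(w in X i @^-1` A) (eta f0 (X i w))%:E)%E
}.

Definition risk (hn : (0 < n)%N) (f : d.-tuple R -> R) : \bar R :=
  'E_P[fun w => loss (Y (Ordinal hn) w) (f (X (Ordinal hn) w))].

Definition empirical_risk (w : W) (f : d.-tuple R -> R) : R :=
  n%:R^-1 * \sum_(i < n) loss (Y i w) (f (X i w)).

End Sample.

Section PriorPosterior.
Context {R : realType} {d L D : nat}.

Definition standard_gaussian_prior (pi : probability (param R d L D) R) : Prop :=
  mutually_independent pi
    (fun (c : coef d L D) (theta : param R d L D) => coefficient theta c) /\
  forall (c : coef d L D) (A : set R), measurable A ->
    pi ((fun theta : param R d L D => coefficient theta c) @^-1` A)
    = normal_prob 0 1 A.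

(* [rho] has density c * exp(- lambda * r) on [Theta] with respect to [pi], and
   none outside [Theta]; since [rho] has total mass 1, c is the inverse of the
   integral of exp(- lambda * r) over [Theta]. *)
Definition gibbs_posterior (pi : probability (param R d L D) R)
    (Theta : set (param R d L D)) (lambda : R) (r : param R d L D -> R)
    (rho : probability (param R d L D) R) : Prop :=
  exists2 c : R, 0 < c & forall A : set (param R d L D), measurable A ->
    rho A =
    (\int[pi]_(theta in A `&` Theta) (c * expR (- (lambda * r theta)))%:E)%E.

End PriorPosterior.

(* a ≍ b with the two constants made explicit. *)
Definition asymp_between {R : realType} (c c' a b : R) : Prop :=
  c * b <= a /\ a <= c' * b.

(* Main.v *)
From HB Require Import structures.
Require Import Defs.
From mathcomp Require Import all_boot all_order all_algebra.
From mathcomp Require Import all_classical all_reals all_analysis.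
From mathcomp Require Import measurable_realfun.
From mathcomp Require Import ring lra.
Set Implicit Arguments.
Unset Strict Implicit.
Unset Printing Implicit Defensive.
Import Order.TTheory GRing.Theory Num.Theory.
Import numFieldNormedType.Exports.
Local Open Scope classical_set_scope.
Local Open Scope ring_scope.

(** Write [z theta s] for the excess loss of the network [theta] over [f0] at the
    observation [s], [excess theta] for its expectation (the excess risk), and
    put [t = 1 / max(2K, C)], so that [lambda = t * n].  Subtracting the losses
    of [f0] does not change the Gibbs posterior, whose density becomes
    proportional to [exp(- t * sum_i z theta (Y_i, X_i))].

    On outputs bounded by [C] the logistic loss varies by at most [C]
    ([loss_oscillation]), so [t * |z| <= 1] and the exponential inequality
    [e^u <= 1 + u + u^2] applies ([expR_le_quadratic]).  With the Bernstein
    condition [E z^2 <= K * excess] and [t * K <= 1/2], the second-order term is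
    at most half of the first-order one:
      [E exp(- t z) <= exp(- t * excess / 2)],
      [E exp(t z) <= exp(3 t * excess / 2)],
    and both bounds tensorize over the independent sample
    ([exponential_moment_total]).  The first one and Tonelli's theorem show that
      [G = \int_Theta exp(lambda * excess / 2) exp(- t sum_i z_i) dpi]
    has expectation at most one ([penalized_evidence_le1]).  The convexity
    inequality [1 + u <= e^u], integrated against the posterior, gives for
    every [s]
      [lambda / 2 * E_post excess <= A + s + e^(-s) G - 1],
    where [e^(-A)] is any lower bound of the evidence
    [\int_Theta exp(- t sum_i z_i) dpi] ([posterior_mean_le]).  This plays the role
    of the variational formula for the Kullback-Leibler divergence.

    For [A], only a small box around a risk minimizer [theta0] is kept in the
    evidence: there [sum_i z_i] exceeds its value at [theta0] by at most
    [n * slack], and the box has prior mass at least [e^(-kappa)], so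
    [A = t * sum_i z_i(theta0) + lambda * slack + kappa] is allowed.  The choice
    [s = 0] and an expectation over the sample give the bound with factor 2
    ([pac_bayes_expectation]); the choice [s = ln (2/delta)], Markov's inequality
    for [G], and the second exponential moment at [theta0] give the bound with
    factor 3 ([pac_bayes_probability]).  The factors 2 and 3 are [1 / (1/2)] and
    [(3/2) / (1/2)].

    It remains to balance [slack] and [kappa].  A network of depth [L] and
    width [D] with coefficients in [[-B, B]] is [L * q^L]-Lipschitz in its
    parameters for the maximum norm, with [q = B * (D + 1)]
    ([network_lipschitz]).  A box of radius [1 / (n * L * q^L)] thus makes
    [slack] equal to [1/n], while [kappa] is at most a constant times
    [L * D^2] (the number of coefficients) times [L * ln n] (the logarithm of
    the inverse radius).  So [kappa / n] is of order [(L * D)^2 * ln n / n],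
    which for the prescribed [L] and [D] is of order [psi_n]
    ([complexity_le_rate]).  The same Lipschitz bound makes the risk continuous on
    the compact box of parameters, hence the minimum is attained. *)

(** * The logistic loss and one exponential inequality *)

Section real_inequalities.
Context {R : realType}.
Implicit Types u v z C : R.

(** For negative arguments [1 / (1 - u)] is a good enough upper bound of [e^u].
    For positive ones it is replaced by [(1 - u/8)^(-8)]: the eighth power is
    the smallest power of two for which the polynomial inequality still holds
    at [u = 1]. *)
Lemma expR_le_quadratic u : `|u| <= 1 -> expR u <= 1 + u + u ^+ 2.
Proof.
rewrite ler_norml => /andP[u1 u2].
have expV : expR u = (expR (- u))^-1 by rewrite expRN invrK.
have [u0|u0] := leP u 0.
  have h : 1 - u <= expR (- u) by exact: expR_ge1Dx.
  have q0 : 0 < 1 - u by lra.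
  rewrite expV (le_trans (y := (1 - u)^-1))// ?lef_pV2 ?posrE ?expR_gt0//.
  rewrite -div1r ler_pdivrMr//; nra.
pose v := u / 8.
have v0 : 0 < v by rewrite /v; lra.
have v1 : v <= 8^-1 by rewrite /v; lra.
have h : (1 - v) ^+ 8 <= expR (- u).
  have -> : - u = 8%:R * - v by rewrite /v; lra.
  rewrite expRM_natl lerXn2r ?nnegrE ?expR_ge0//; first by lra.
  exact: expR_ge1Dx.
have q0 : 0 < (1 - v) ^+ 8 by rewrite exprn_gt0//; lra.
rewrite expV (le_trans (y := ((1 - v) ^+ 8)^-1))// ?lef_pV2 ?posrE ?expR_gt0//.
have -> : u = 8 * v by rewrite /v; lra.
rewrite -div1r ler_pdivrMr//.
have v2 : 0 <= v ^+ 2 by rewrite sqr_ge0.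
(* With v = u/8, the product (1 + 8v + 64v^2)(1 - v)^8 - 1 is v^2 times the
   first cubic below plus v^6 times the quartic, both nonnegative up to 1/8. *)
have q1 : 0 <= 28 - 344 * v + 1414 * v ^+ 2 - 3080 * v ^+ 3.
  have : 0 <= (8^-1 - v) * v ^+ 2 by apply: mulr_ge0 => //; lra.
  have : 0 <= (8^-1 - v) ^+ 2 by rewrite sqr_ge0.
  by rewrite !exprS expr0 !mulr1; lra.
have q2 : 0 <= 4060 - 3368 * v + 1729 * v ^+ 2 - 504 * v ^+ 3 + 64 * v ^+ 4.
  have : 0 <= (8^-1 - v) * v ^+ 2 by apply: mulr_ge0 => //; lra.
  have : 0 <= v ^+ 4 by apply: exprn_ge0; lra.
  by rewrite !exprS expr0 !mulr1; lra.
have q3 := mulr_ge0 v2 q1.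
have q4 := mulr_ge0 (mulr_ge0 (mulr_ge0 v2 v2) v2) q2.
suff -> : (1 + 8 * v + (8 * v) ^+ 2) * (1 - v) ^+ 8 = 1
   + v ^+ 2 * (28 - 344 * v + 1414 * v ^+ 2 - 3080 * v ^+ 3)
   + v ^+ 2 * v ^+ 2 * v ^+ 2 * (4060 - 3368 * v + 1729 * v ^+ 2 - 504 * v ^+ 3 + 64 * v ^+ 4).
  by rewrite -addrA lerDl addr_ge0.
ring.
Qed.
End real_inequalities.

Section logistic_loss.
Context {R : realType}.
Implicit Types y u v C : R.

Lemma measurable_loss : measurable_fun setT (fun p : R * R => loss p.1 p.2).
Proof.
apply: (measurableT_comp (@measurable_ln R)); apply: measurable_funD => //.
apply: measurableT_comp => //; apply: measurableT_comp => //.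
exact: measurable_funM.
Qed.

(** The upper bound holds because multiplying [1 + e^a] by [e^(b - a) >= 1] gives
    at least [1 + e^b]. *)
Lemma softplus_bounds (a b : R) : a <= b ->
  0 <= ln (1 + expR b) - ln (1 + expR a) <= b - a.
Proof.
move=> ab; have pos c : 0 < 1 + expR c :> R by rewrite addr_gt0// expR_gt0.
apply/andP; split; first by rewrite subr_ge0 ler_ln ?posrE// lerD2l ler_expR.
rewrite lerBlDr -[b - a]expRK -lnM ?posrE ?expR_gt0// ler_ln ?posrE ?mulr_gt0 ?expR_gt0//.
by rewrite mulrDr mulr1 -expRD subrK lerD// -expR0 ler_expR subr_ge0.
Qed.

Lemma loss_lipschitz y u v : y = -1 \/ y = 1 ->
  `|loss y u - loss y v| <= `|u - v|.
Proof.
move=> hy; wlog uv : u v / - (y * u) <= - (y * v) => [H|].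
  have [/H//|/ltW/H] := leP (- (y * u)) (- (y * v)).
  by rewrite distrC (distrC u).
have /andP[h1 h2] := softplus_bounds uv.
rewrite distrC ger0_norm//; apply: (le_trans h2).
rewrite (le_trans (ler_norm _))// opprK addrC -mulrBr normrM.
by case: hy => ->; rewrite ?normrN normr1 mul1r.
Qed.

(** On [[-C, C]] the logistic loss oscillates by exactly [C], although its
    Lipschitz constant only gives [2 * C]: the slopes at opposite points add
    up to one. *)
Lemma loss_oscillation C y u v : y = -1 \/ y = 1 -> `|u| <= C -> `|v| <= C ->
  `|loss y u - loss y v| <= C.
Proof.
move=> hy hu hv.
have bd w : `|w| <= C -> - C <= - (y * w) <= C.
  by rewrite ler_norml => /andP[? ?]; case: hy => ->; lra.
have end_gap : ln (1 + expR C) = C + ln (1 + expR (- C)).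
  transitivity (ln (expR C) + ln (1 + expR (- C))); last by rewrite expRK.
  rewrite -lnM ?posrE ?addr_gt0 ?expR_gt0//.
  by rewrite mulrDr mulr1 -expRD subrr expR0 addrC.
have /andP[u1 u2] := bd u hu; have /andP[v1 v2] := bd v hv.
have /andP[a1 _] := softplus_bounds u1; have /andP[a2 _] := softplus_bounds u2.
have /andP[b1 _] := softplus_bounds v1; have /andP[b2 _] := softplus_bounds v2.
by rewrite ler_norml /loss; lra.
Qed.
End logistic_loss.

(** * Densities, products of independent variables, bounded functions *)

Section density.
Local Open Scope ereal_scope.
Context {d1 d2 : measure_display} {W : measurableType d1} {T : measurableType d2}.
Context {R : realType}.
Import HBNNSimple.

(** The density formula and the change of variables formula in one statement:
    the hypothesis says that [nu] is the image under [phi] of the measure with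
    density [F] on [D].  With [phi] the identity it computes integrals against
    the Gibbs posterior; with [F] a product of functions of some observations
    and [phi] another observation, it is the induction step of
    [integral_prod_independent]. *)
Lemma ge0_integral_density (mu : {measure set W -> \bar R})
    (nu : {measure set T -> \bar R}) (D : set W) (F : W -> R) (phi : W -> T)
    (g : T -> \bar R) :
  measurable D -> measurable_fun setT phi ->
  measurable_fun setT F -> (forall x, 0 <= F x)%R ->
  (forall A, measurable A -> \int[mu]_(x in phi @^-1` A `&` D) (F x)%:E = nu A) ->
  measurable_fun setT g -> (forall y, 0 <= g y) ->
  \int[mu]_(x in D) (g (phi x) * (F x)%:E) = \int[nu]_y g y.
Proof.
move=> mD mphi mF F0 FE mg g0.
have mFD : measurable_fun D (EFin \o F) by apply/measurable_EFinP/measurable_funTS.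
pose h := nnsfun_approx measurableT mg.
have gE y : g y = lim ((EFin \o h n) y @[n --> \oo]).
  by apply/esym/cvg_lim => //; exact: cvg_nnsfun_approx.
have -> : \int[nu]_y g y = lim (\int[nu]_y (EFin \o h n) y @[n --> \oo]).
  under eq_integral => y _ do rewrite gE.
  apply: monotone_convergence => //.
  - by move=> n; apply/measurable_EFinP.
  - by move=> n x _ //=; rewrite lee_fin.
  - by move=> x _ a b ab; rewrite lee_fin; exact/lefP/nd_nnsfun_approx.
have mh n : measurable_fun setT (h n \o phi) by apply: measurableT_comp.
have -> : \int[mu]_(x in D) (g (phi x) * (F x)%:E) =
    lim (\int[mu]_(x in D) ((EFin \o h n) (phi x) * (F x)%:E) @[n --> \oo]).
  have fg x : g (phi x) * (F x)%:E =
      lim (((EFin \o h n) (phi x) * (F x)%:E) @[n --> \oo]).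
    by apply/esym/cvg_lim => //; apply: cvgeZr => //; exact: cvg_nnsfun_approx.
  under eq_integral => x _ do rewrite fg.
  apply: monotone_convergence => [//| | |].
  - move=> n; apply/emeasurable_funM => //; apply/measurable_funTS.
    by apply/measurable_EFinP => /=; exact: mh.
  - by move=> n x _ /=; rewrite mule_ge0 ?lee_fin.
  - move=> x _ a b ab/=; rewrite lee_wpmul2r ?lee_fin//.
    exact/lefP/nd_nnsfun_approx.
suff suf n : \int[mu]_(x in D) ((EFin \o h n) (phi x) * (F x)%:E) =
    \int[nu]_x (EFin \o h n) x.
  by under eq_fun do rewrite suf.
have mpre r : measurable (phi @^-1` (h n @^-1` [set r])).
  by rewrite -(setTI (_ @^-1` _)); apply: mphi.
have hE x : (EFin \o h n) x =
    \sum_(y \in range (h n)) (y * \1_(h n @^-1` [set y]) x)%:E.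
  by rewrite /= fimfunE -fsumEFin.
under [RHS]eq_integral do rewrite hE.
rewrite ge0_integral_fsum//; last 2 first.
- by move=> r; apply/measurable_EFinP; exact: measurable_funM.
- by move=> m y Ey; exact: nnfun_muleindic_ge0.
transitivity (\int[mu]_(x in D) (\sum_(y \in range (h n))
    (y * \1_(h n @^-1` [set y]) (phi x))%:E * (F x)%:E)).
  by apply: eq_integral => x _; rewrite hE ge0_mule_fsuml// => y;
    exact: nnfun_muleindic_ge0.
rewrite ge0_integral_fsum//; last 2 first.
- move=> y; apply: emeasurable_funM => //; apply/measurable_funTS.
  apply/measurable_EFinP; apply: measurable_funM => //.
  by apply: measurableT_comp.
- by move=> r x _; rewrite mule_ge0 ?lee_fin// -lee_fin nnfun_muleindic_ge0.
apply: eq_fsbigr => r /[!inE] -[x _ hxr].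
have r0 : (0 <= r)%R by rewrite -hxr.
transitivity (r%:E * nu (h n @^-1` [set r])); last first.
  by rewrite integralZl_indic_nnsfun// integral_indic// setIT.
under eq_integral do rewrite EFinM -muleA.
rewrite ge0_integralZl//; first last.
- by move=> y _; rewrite mule_ge0 ?lee_fin.
- apply: emeasurable_funM => //; apply/measurable_funTS/measurable_EFinP.
  by apply: measurableT_comp.
congr (_ * _); rewrite -FE// setIC integral_mkcondr; apply: eq_integral => y _.
rewrite patchE indicE/=; case: ifPn => [/set_mem/= yr|yr].
  by rewrite mem_set// mul1e.
by rewrite memNset ?mul0e// => hr; move/negP: yr; apply; exact/mem_set.
Qed.
End density.

Section independence.
Local Open Scope ereal_scope.
Context {R : realType} {d1 d2 : measure_display}.
Context {W : measurableType d1} {S : measurableType d2}.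
Context (P : probability W R) (I : finType) (Z : I -> W -> S).
Context (mZ : forall i, measurable_fun setT (Z i)).

Lemma measurable_prod_observations (h : I -> S -> R) (p : pred I) :
  (forall i, measurable_fun setT (h i)) ->
  measurable_fun setT (fun w => \prod_(i | p i) h i (Z i w))%R.
Proof.
move=> mh; under eq_fun do rewrite -big_filter.
by apply: measurable_prod => i _; apply: measurableT_comp.
Qed.

Lemma integral_indic_observation (i : I) (A : set S) : measurable A ->
  \int[P]_w (\1_A (Z i w))%:E = P (Z i @^-1` A).
Proof.
move=> mA; rewrite (_ : (fun w => _) = fun w => (\1_(Z i @^-1` A) w)%:E).
  by rewrite integral_indic ?setIT// -[X in measurable X]setTI; exact: mZ.
by apply/funext => w; rewrite !indicE; congr (_%:R%:E); apply/idP/idP => /set_mem ?; exact/mem_set.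
Qed.

(** Independence gives the formula when every factor is an indicator.  General
    factors are then substituted for indicators one index at a time: with the
    other factors fixed, both sides are measures in the set defining the
    remaining indicator. *)
Lemma integral_prod_independent (h : I -> S -> R) (a : I -> R) :
  mutually_independent P Z ->
  (forall i, measurable_fun setT (h i)) -> (forall i s, 0 <= h i s)%R ->
  (forall i, \int[P]_w (h i (Z i w))%:E = (a i)%:E) ->
  \int[P]_w (\prod_i h i (Z i w))%R%:E = (\prod_i a i)%R%:E.
Proof.
move=> ind mh h0 ha.
suff main : forall (s : seq I) (h : I -> S -> R) (a : I -> R),
    (forall i, measurable_fun setT (h i)) -> (forall i s, 0 <= h i s)%R ->
    (forall i, \int[P]_w (h i (Z i w))%:E = (a i)%:E) ->
    (forall i, i \notin s ->
       exists2 A : set S, measurable A & h i = (\1_A : S -> R)) ->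
    \int[P]_w (\prod_i h i (Z i w))%R%:E = (\prod_i a i)%R%:E.
  by apply: (main (enum I)) => // i; rewrite mem_enum.
elim=> [|j s IH] {h a mh h0 ha} h a mh h0 ha hind.
  have {}hind i : exists A : set S, measurable A /\ h i = (\1_A : S -> R).
    by have [A mA hA] := hind i isT; exists A.
  have [A hA] := choice hind.
  have mA i : measurable (A i) by have [] := hA i.
  have aE i : P (Z i @^-1` A i) = (a i)%:E.
    by rewrite -integral_indic_observation// -ha (hA i).2.
  have <- : \prod_(i in [set: I]%SET) P (Z i @^-1` A i) = (\prod_i a i)%R%:E.
    by rewrite -prodEFin; apply: eq_big => [i|i _]; [rewrite finset.in_setT|rewrite aE].
  rewrite -ind//.
  have mC : measurable (\bigcap_(i in [set i | i \in [set: I]%SET]) Z i @^-1` A i).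
    apply: fin_bigcap_measurable => [|i _]; first exact: finite_finset.
    by rewrite -[X in measurable X]setTI; exact: mZ.
  rewrite -[in RHS](setIT (\bigcap_(i in _) _)) -integral_indic//.
  apply: eq_integral => w _; congr _%:E; rewrite indicE.
  case: (pselect ((\bigcap_(i in [set i | i \in [set: I]%SET]) Z i @^-1` A i) w)) => hw.
    rewrite mem_set// big1// => i _; rewrite (hA i).2 indicE mem_set//.
    by apply: hw; rewrite /= inE.
  rewrite memNset//; have [i hi] : exists i, ~ A i (Z i w).
    by apply/existsNP => H; apply: hw => i _; exact: H.
  by rewrite (bigD1 i)//= (hA i).2 indicE memNset// mul0r.
pose c := (\prod_(i | i != j) a i)%R.
have a0 i : (0 <= a i)%R.
  by rewrite -lee_fin -ha integral_ge0// => w _; rewrite lee_fin.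
have c0 : (0 <= c)%R by apply: prodr_ge0.
pose Zj : {mfun W >-> S} := HB.pack (Z j) (isMeasurableFun.Build _ _ _ _ _ (mZ j)).
pose nu := mscale (NngNum c0) (distribution P Zj).
pose F w := (\prod_(i | i != j) h i (Z i w))%R.
have mF : measurable_fun setT F by exact: measurable_prod_observations.
have F0 w : (0 <= F w)%R by apply: prodr_ge0.
transitivity (\int[P]_w ((EFin \o h j) (Z j w) * (F w)%:E)).
  by apply: eq_integral => w _; rewrite (bigD1 j)//= EFinM.
rewrite (ge0_integral_density (nu := nu))//; last 3 first.
- move=> A mA; rewrite setIT /nu /mscale/= /distribution/= /pushforward.
  pose h' i := if i == j then (\1_A : S -> R) else h i.
  pose a' i := if i == j then fine (P (Z j @^-1` A)) else a i.
  have mZA : measurable (Z j @^-1` A) by rewrite -[X in measurable X]setTI; exact: mZ.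
  have a'E : (\prod_i a' i = fine (P (Z j @^-1` A)) * c)%R.
    rewrite (bigD1 j)//= {1}/a' eqxx; congr (_ * _)%R; apply: eq_bigr => i /negPf ij.
    by rewrite /a' ij.
  transitivity ((fine (P (Z j @^-1` A)) * c)%:E); last first.
    by rewrite EFinM fineK ?fin_num_measure// muleC.
  rewrite -a'E -(IH h').
  + rewrite integral_mkcond; apply: eq_integral => w _.
    rewrite patchE (bigD1 j)//= {1}/h' eqxx indicE.
    rewrite (eq_bigr (fun i => h i (Z i w))); last first.
      by move=> i /negPf ij; rewrite /h' ij.
    case: ifPn => [/set_mem/= wA|wA]; first by rewrite mem_set// mul1r.
    by rewrite memNset ?mul0r// => hw; move/negP: wA; apply; exact/mem_set.
  + by move=> i; rewrite /h'; case: ifP.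
  + by move=> i x; rewrite /h'; case: ifP => // _; rewrite indicE.
  + move=> i; rewrite /h' /a'; case: eqP => [->|_]; last exact: ha.
    by rewrite integral_indic_observation// fineK// fin_num_measure.
  + move=> i ijs; rewrite /h'; case: eqP => [_|/eqP ij]; first by exists A.
    by apply: hind; rewrite inE negb_or ij.
- exact/measurable_EFinP.
- by move=> y; rewrite /= lee_fin.
rewrite ge0_integral_mscale//=; last 2 first.
- exact/measurable_EFinP.
- by move=> y _; rewrite lee_fin.
rewrite ge0_integral_pushforward//=; last 2 first.
- exact/measurable_EFinP.
- by move=> y _; rewrite lee_fin.
by rewrite [X in _ * X]ha -EFinM mulrC [in RHS](bigD1 j).
Qed.
End independence.

Section bounded_measurable.
Context {R : realType} {d : measure_display} {T : measurableType d}.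

(** Over a probability space this class consists of integrable functions, and
    it is stable under all the operations below, which settles every
    integrability condition of the proof. *)
Definition bounded_measurable (f : T -> R) :=
  measurable_fun setT f /\ exists M, forall x, `|f x| <= M.

Lemma bounded_measurable_cst (r : R) : bounded_measurable (cst r).
Proof. by split; [exact: measurable_cst|exists `|r|]. Qed.

Lemma bounded_measurableN f :
  bounded_measurable f -> bounded_measurable (fun x => - f x).
Proof.
move=> [mf [M hM]]; split; first exact: measurableT_comp.
by exists M => x; rewrite normrN.
Qed.

Lemma bounded_measurable_norm f :
  bounded_measurable f -> bounded_measurable (fun x => `|f x|).
Proof.
move=> [mf [M hM]]; split; first exact: measurableT_comp.
by exists M => x; rewrite normr_id.
Qed.

Lemma bounded_measurableD f g : bounded_measurable f -> bounded_measurable g ->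
  bounded_measurable (fun x => f x + g x).
Proof.
move=> [mf [M hM]] [mg [M' hM']]; split; first exact: measurable_funD.
by exists (M + M') => x; rewrite (le_trans (ler_normD _ _))// lerD.
Qed.

Lemma bounded_measurableM f g : bounded_measurable f -> bounded_measurable g ->
  bounded_measurable (fun x => f x * g x).
Proof.
move=> [mf [M hM]] [mg [M' hM']]; split; first exact: measurable_funM.
by exists (M * M') => x; rewrite normrM ler_pM.
Qed.

Lemma bounded_measurableZ (r : R) f :
  bounded_measurable f -> bounded_measurable (fun x => r * f x).
Proof. by apply: bounded_measurableM; exact: bounded_measurable_cst. Qed.

Lemma bounded_measurable_sum (I : Type) (s : seq I) (f : I -> T -> R) :
  (forall i, bounded_measurable (f i)) ->
  bounded_measurable (fun x => \sum_(i <- s) f i x).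
Proof.
move=> hf; elim: s => [|i s IH].
  by under eq_fun do rewrite big_nil; exact: bounded_measurable_cst.
by under eq_fun do rewrite big_cons; exact: bounded_measurableD.
Qed.

Lemma bounded_measurable_expR f :
  bounded_measurable f -> bounded_measurable (fun x => expR (f x)).
Proof.
move=> [mf [M hM]]; split; first exact: measurableT_comp.
exists (expR M) => x; rewrite ger0_norm ?expR_ge0// ler_expR.
exact: le_trans (ler_norm _) (hM x).
Qed.

Lemma bounded_measurable_integrable (mu : probability T R) (D : set T) f :
  measurable D -> bounded_measurable f -> mu.-integrable D (EFin \o f).
Proof.
move=> mD [mf [M hM]]; apply: (integrableS measurableT) => //.
apply: measurable_bounded_integrable => //.
  by rewrite -ge0_fin_numE// fin_num_measure.
exists M; split; first exact: num_real.
by move=> N /ltW MN x _; exact: le_trans (hM x) MN.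
Qed.

Lemma EFin_Rintegral (mu : probability T R) (D : set T) f :
  measurable D -> bounded_measurable f ->
  (\int[mu]_(x in D) (f x)%:E)%E = (\int[mu]_(x in D) f x)%:E.
Proof.
move=> mD hf; rewrite fineK// integrable_fin_num//.
exact: bounded_measurable_integrable.
Qed.

Lemma Rintegral_probability_cst (mu : probability T R) (r : R) :
  \int[mu]_x r = r.
Proof.
by rewrite Rintegral_cst//= probability_setT mulr1.
Qed.

Lemma measurable_le_set (f : T -> R) (r : R) :
  measurable_fun setT f -> measurable [set x | f x <= r].
Proof.
move=> mf; rewrite -[X in measurable X]setTI.
have -> : [set x | f x <= r] = f @^-1` [set` `]-oo, r]].
  by apply/seteqP; split=> x /=; rewrite in_itv.
exact: mf.
Qed.

Lemma markov_bounded (mu : probability T R) (f : T -> R) (b : R) :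
  0 < b -> bounded_measurable f -> (forall x, 0 <= f x) ->
  \int[mu]_x f x <= 1 -> (mu (~` [set x | (f x <= b)%R]) <= b^-1%:E)%E.
Proof.
move=> b0 bf f0 f1; set A := ~` _.
have mA : measurable A by apply/measurableC/measurable_le_set; case: bf.
rewrite -(@lee_pmul2l _ b%:E)// -EFinM mulfV ?gt_eqF//.
apply: (@le_trans _ _ (\int[mu]_x f x)%:E); last by rewrite lee_fin.
rewrite -EFin_Rintegral// -[A]setIT -integral_indic// -ge0_integralZl//; last 2 first.
- exact/measurable_EFinP/measurable_indic.
- by rewrite lee_fin ltW.
apply: ge0_le_integral => //.
- by move=> x _; rewrite lee_fin mulr_ge0 ?(ltW b0)// indicE.
- by apply/measurable_EFinP/measurable_funM => //; exact: measurable_indic.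
- by apply/measurable_EFinP; case: bf.
move=> x _; rewrite lee_fin indicE; case: (boolP (x \in A)) => [/set_mem/negP|_].
  by rewrite mulr1 -ltNge => /ltW.
by rewrite mulr0.
Qed.
End bounded_measurable.

Lemma bounded_measurable_comp {R : realType} {d d' : measure_display}
    {T : measurableType d} {T' : measurableType d'} (f : T -> R) (g : T' -> T) :
  bounded_measurable f -> measurable_fun setT g -> bounded_measurable (f \o g).
Proof.
move=> [mf [M hM]] mg; split; first exact: measurableT_comp.
by exists M => x; exact: hM.
Qed.

Section partial_integral.
Context {R : realType} {d1 d2 : measure_display}.
Context {W : measurableType d1} {T : measurableType d2}.

(** Adding the bound [M] makes the integrand nonnegative, so that Tonelli's
    theorem applies. *)
Lemma measurable_Rintegral (mu : probability T R) (D : set T)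
    (f : W -> T -> R) :
  measurable D -> bounded_measurable (fun p : W * T => f p.1 p.2) ->
  bounded_measurable (fun w => \int[mu]_(x in D) f w x).
Proof.
move=> mD [mf [M hM]].
have M0 : 0 <= M by exact: le_trans (normr_ge0 _) (hM (point, point)).
have mfw w : bounded_measurable (f w).
  split; last by exists M => x; exact: (hM (w, x)).
  by have := measurableT_comp mf (measurable_pair1 w); apply.
pose g (p : W * T) := ((f p.1 p.2 + M) * \1_D p.2)%:E.
have hg p : (0 <= g p)%E.
  rewrite lee_fin mulr_ge0// ?indicE//.
  by rewrite -lerBlDr sub0r; have := hM p; rewrite ler_norml => /andP[].
have mg : measurable_fun setT g.
  apply/measurable_EFinP; apply: measurable_funM; first exact: measurable_funD.
  by apply: measurableT_comp => //; exact: measurable_indic.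
have fE w : \int[mu]_(x in D) f w x = fine (fubini_F mu g w) - M * fine (mu D).
  rewrite -Rintegral_cst// /fubini_F.
  rewrite (_ : fine (\int[mu]_y g (w, y))%E = \int[mu]_(y in D) (f w y + M)).
    rewrite -RintegralB//; [|apply: bounded_measurable_integrable => //..].
    - by under [RHS]eq_Rintegral do rewrite addrK.
    - by apply: bounded_measurableD => //; exact: bounded_measurable_cst.
    - exact: bounded_measurable_cst.
  rewrite Rintegral_mkcond; congr fine; apply: eq_integral => y _.
  by rewrite /g patchE indicE; case: ifP => _; rewrite ?mulr1 ?mulr0.
split; last first.
  exists M => w.
  have := le_normr_Rintegral mD (bounded_measurable_integrable mu mD (mfw w)).
  move=> /le_trans; apply.
  rewrite (@le_trans _ _ (\int[mu]_(x in D) M))//.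
    apply: le_Rintegral => //; try apply: bounded_measurable_integrable => //.
    - exact: bounded_measurable_norm.
    - exact: bounded_measurable_cst.
    - by move=> x _; exact: (hM (w, x)).
  rewrite Rintegral_cst// ler_piMr//.
  by rewrite -lee_fin fineK ?fin_num_measure// probability_le1.
under eq_fun do rewrite fE.
apply: measurable_funB => //; apply: measurableT_comp => //.
exact: measurable_fun_fubini_tonelli_F.
Qed.
End partial_integral.

(** * A PAC-Bayes bound under a Bernstein condition *)

Section bounded_measurable_pair.
Context {R : realType} {d1 d2 : measure_display}.
Context {W : measurableType d1} {T : measurableType d2}.

Lemma bounded_measurable_section1 (f : W -> T -> R) (w : W) :
  bounded_measurable (fun p : W * T => f p.1 p.2) -> bounded_measurable (f w).
Proof.
move=> [mf [M hM]]; split; last by exists M => x; exact: (hM (w, x)).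
by have := measurableT_comp mf (measurable_pair1 w); apply.
Qed.

Lemma bounded_measurable_section2 (f : W -> T -> R) (x : T) :
  bounded_measurable (fun p : W * T => f p.1 p.2) ->
  bounded_measurable (f ^~ x).
Proof.
move=> [mf [M hM]]; split; last by exists M => w; exact: (hM (w, x)).
by have := measurableT_comp mf (measurable_pair2 x); apply.
Qed.
End bounded_measurable_pair.

Section excess_risk.
Context {R : realType} {dW dS dT : measure_display}.
Context {W : measurableType dW} {S : measurableType dS} {T : measurableType dT}.
Context (P : probability W R) (I : finType) (i0 : I) (Z : I -> W -> S).
Context (z : T -> S -> R) (C K t : R).
Context (mZ : forall i, measurable_fun setT (Z i)).
Context (indZ : mutually_independent P Z) (idZ : identically_distributed P Z).
Context (mz : measurable_fun setT (fun p : T * S => z p.1 p.2)).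
Context (zC : forall a s, `|z a s| <= C).

Definition excess (a : T) : R := \int[P]_w z a (Z i0 w).
Definition total_excess (w : W) (a : T) : R := \sum_i z a (Z i w).

Lemma bounded_measurable_in_observation a : bounded_measurable (z a).
Proof.
apply: (@bounded_measurable_section1 _ _ _ _ _ z); split => //.
by exists C => x; exact: zC.
Qed.

Lemma bounded_measurable_jointly i :
  bounded_measurable (fun p : W * T => z p.2 (Z i p.1)).
Proof.
split; last by exists C => p; exact: zC.
exact: (measurableT_comp mz (measurable_fun_pair measurable_snd
  (measurableT_comp (mZ i) measurable_fst))).
Qed.

Lemma bounded_measurable_total :
  bounded_measurable (fun p : W * T => total_excess p.1 p.2).
Proof. by apply: bounded_measurable_sum => i; exact: bounded_measurable_jointly. Qed.

Lemma bounded_measurable_excess : bounded_measurable excess.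
Proof.
apply: (@measurable_Rintegral _ _ _ _ _ P setT (fun a w => z a (Z i0 w))) => //.
split; last by exists C => p; exact: zC.
exact: (measurableT_comp mz (measurable_fun_pair measurable_fst
  (measurableT_comp (mZ i0) measurable_snd))).
Qed.

(** Both sides are integrals against the image measure, common to all indices. *)
Lemma identical_Rintegral (g : S -> R) i : bounded_measurable g ->
  \int[P]_w g (Z i w) = \int[P]_w g (Z i0 w).
Proof.
move=> hg; congr fine; pose Zm j : {mfun W >-> S} :=
  HB.pack (Z j) (isMeasurableFun.Build _ _ _ _ _ (mZ j)).
have E j : (\int[P]_w (g (Z j w))%:E = \int[distribution P (Zm j)]_s (g s)%:E)%E.
  rewrite integral_pushforward//.
    by case: hg => mg _; exact/measurable_EFinP.
  rewrite preimage_setT; apply: (bounded_measurable_integrable P measurableT).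
  exact: (bounded_measurable_comp hg (mZ j)).
by rewrite !E; apply: eq_measure_integral => A mA _; exact: idZ.
Qed.

Context (K0 : 0 < K) (t0 : 0 < t) (tC : t * C <= 1) (tK : t * K <= 2^-1).
Context (bernstein : forall a, \int[P]_w (z a (Z i0 w)) ^+ 2 <= K * excess a).

Lemma excess_ge0 a : 0 <= excess a.
Proof.
rewrite -(pmulr_rge0 _ K0) (le_trans _ (bernstein a))// Rintegral_ge0// => w _.
exact: sqr_ge0.
Qed.

Lemma bounded_measurable_in_sample i a : bounded_measurable (fun w => z a (Z i w)).
Proof. by apply: (bounded_measurable_comp (bounded_measurable_in_observation a) (mZ i)). Qed.

Lemma Rintegral_quadratic (r : R) a :
  \int[P]_w (1 + r * z a (Z i0 w) + r ^+ 2 * (z a (Z i0 w)) ^+ 2) =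
  1 + r * excess a + r ^+ 2 * \int[P]_w (z a (Z i0 w)) ^+ 2.
Proof.
have h1 := bounded_measurable_in_sample i0 a.
have h2 : bounded_measurable (fun w => (z a (Z i0 w)) ^+ 2).
  exact: (bounded_measurableM h1 h1).
have c (s : R) := @bounded_measurable_cst R _ W s.
rewrite RintegralD//; last 2 first.
- apply: bounded_measurable_integrable => //.
  by apply: bounded_measurableD; [exact: c|exact: bounded_measurableZ].
- by apply: bounded_measurable_integrable => //; exact: bounded_measurableZ.
rewrite RintegralD//; last 2 first.
- by apply: bounded_measurable_integrable => //; exact: c.
- by apply: bounded_measurable_integrable => //; exact: bounded_measurableZ.
by rewrite Rintegral_probability_cst !RintegralZl//; exact: bounded_measurable_integrable.
Qed.

(** For [r = t] or [r = -t] the quadratic term contributes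
    [t^2 * E z^2 <= t * (t * K) * excess <= t / 2 * excess]. *)
Lemma exponential_moment (r : R) i a : `|r| = t ->
  \int[P]_w expR (r * z a (Z i w)) <= expR ((r + t / 2) * excess a).
Proof.
move=> rt; have c (s : R) := @bounded_measurable_cst R _ W s.
have hz j := bounded_measurable_in_sample j a.
have hz2 : bounded_measurable (fun w => (z a (Z i0 w)) ^+ 2).
  exact: (bounded_measurableM (hz i0) (hz i0)).
have hs : bounded_measurable (fun s => expR (r * z a s)).
  by apply: bounded_measurable_expR; apply: bounded_measurableZ;
    exact: bounded_measurable_in_observation.
rewrite (identical_Rintegral i hs).
apply: (@le_trans _ _ (\int[P]_w (1 + r * z a (Z i0 w) + r ^+ 2 * (z a (Z i0 w)) ^+ 2))).
  apply: le_Rintegral => //.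
  - by apply: bounded_measurable_integrable => //; exact: (bounded_measurable_comp hs).
  - apply: bounded_measurable_integrable => //.
    apply: bounded_measurableD; last exact: bounded_measurableZ.
    by apply: bounded_measurableD; [exact: c|exact: bounded_measurableZ].
  - move=> w _; rewrite -exprMn expR_le_quadratic// normrM rt.
    by rewrite (le_trans _ tC)// ler_wpM2l// ltW.
rewrite Rintegral_quadratic (le_trans _ (expR_ge1Dx _))// mulrDl addrA lerD2l.
rewrite -real_normK ?num_real// rt expr2 -mulrA.
rewrite -mulrA ler_wpM2l ?(ltW t0)//.
rewrite (le_trans (y := t * (K * excess a)))//; first by rewrite ler_wpM2l ?(ltW t0).
by rewrite mulrA ler_wpM2r// excess_ge0.
Qed.

Lemma exponential_moment_total (r : R) a : `|r| = t ->
  \int[P]_w expR (r * total_excess w a) <=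
  expR (#|I|%:R * ((r + t / 2) * excess a)).
Proof.
move=> rt.
have hs : bounded_measurable (fun s => expR (r * z a s)).
  by apply: bounded_measurable_expR; apply: bounded_measurableZ;
    exact: bounded_measurable_in_observation.
pose m i := \int[P]_w expR (r * z a (Z i w)).
have prodE : \int[P]_w expR (r * total_excess w a) = \prod_i m i.
  have hm i : (\int[P]_w (expR (r * z a (Z i w)))%:E)%E = (m i)%:E.
    by rewrite EFin_Rintegral//; exact: (bounded_measurable_comp hs (mZ i)).
  apply: EFin_inj; rewrite -(integral_prod_independent mZ indZ (fun _ => hs.1)
    (fun _ _ => expR_ge0 _) hm) -EFin_Rintegral//; last first.
    apply: bounded_measurable_expR; apply: bounded_measurableZ.
    by apply: bounded_measurable_sum => i; exact: bounded_measurable_in_sample.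
  by apply: eq_integral => w _; rewrite mulr_sumr expR_sum.
rewrite prodE mulr_natl -sumr_const expR_sum.
apply: ler_prod => i _; apply/andP; split; last exact: exponential_moment.
by apply: Rintegral_ge0 => w _; exact: expR_ge0.
Qed.

Lemma Rintegral_total a :
  \int[P]_w total_excess w a = #|I|%:R * excess a.
Proof.
apply: EFin_inj; rewrite -EFin_Rintegral//; last first.
  by apply: bounded_measurable_sum => i; exact: bounded_measurable_in_sample.
under eq_integral do rewrite -sumEFin.
rewrite integral_sum//; last first.
  by move=> i; apply: bounded_measurable_integrable => //; exact: bounded_measurable_in_sample.
under eq_bigr => i _.
  rewrite EFin_Rintegral//; last exact: bounded_measurable_in_sample.
  rewrite (identical_Rintegral i (bounded_measurable_in_observation a)); over.
by rewrite sumEFin sumr_const mulr_natl.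
Qed.

Context (pi : probability T R) (Theta : set T) (mTheta : measurable Theta).
Context (rho : W -> probability T R) (c : W -> R).
Context (c0 : forall w, 0 < c w).

Definition likelihood (w : W) (a : T) : R := expR (- (t * total_excess w a)).

(* The normalization [c w] may differ from that of the posterior in terms of
   losses by a factor that depends on the sample only. *)
Context (rhoE : forall w A, measurable A ->
  rho w A = (\int[pi]_(a in A `&` Theta) (c w * likelihood w a)%:E)%E).

Let lambda := t * #|I|%:R.

Lemma bounded_measurable_likelihood :
  bounded_measurable (fun p : W * T => likelihood p.1 p.2).
Proof.
apply: bounded_measurable_expR; apply: bounded_measurableN.
by apply: bounded_measurableZ; exact: bounded_measurable_total.
Qed.

Let mlik w : bounded_measurable (likelihood w).
Proof. exact: (bounded_measurable_section1 w bounded_measurable_likelihood). Qed.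

Lemma posterior_Rintegral w (g : T -> R) :
  bounded_measurable g -> (forall a, 0 <= g a) ->
  \int[rho w]_a g a = c w * \int[pi]_(a in Theta) (g a * likelihood w a).
Proof.
move=> mg g0.
have mgl := bounded_measurableM mg (mlik w).
rewrite -RintegralZl//; last exact: bounded_measurable_integrable.
apply: EFin_inj; rewrite -!EFin_Rintegral//; last exact: bounded_measurableZ.
rewrite -(ge0_integral_density (mu := pi) (D := Theta) (phi := idfun)
  (F := fun a => c w * likelihood w a))//.
- by apply: eq_integral => a _; rewrite -EFinM mulrCA.
- exact: measurable_id.
- by have [] := bounded_measurableZ (c w) (mlik w).
- by move=> a; rewrite mulr_ge0 ?expR_ge0// ltW.
- by move=> A mA; exact/esym/rhoE.
- by apply/measurable_EFinP; case: mg.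
Qed.

(** The posterior has total mass one, so [c w] is the inverse of the evidence. *)
Lemma posterior_normalization w :
  c w * \int[pi]_(a in Theta) likelihood w a = 1.
Proof.
have := posterior_Rintegral w (bounded_measurable_cst 1) (fun=> ler01).
rewrite Rintegral_probability_cst => ->; congr (_ * _).
by apply: eq_Rintegral => a _; rewrite mul1r.
Qed.

Definition posterior_mean (w : W) : R := \int[rho w]_a excess a.

Lemma bounded_measurable_posterior_mean : bounded_measurable posterior_mean.
Proof.
split.
  (* Explicit quotient of two integrals against the prior, both measurable in
     the sample; the inverse is a power, which is a measurable function. *)
  have -> : posterior_mean = fun w => (\int[pi]_(a in Theta) likelihood w a) `^ (-1) *
      \int[pi]_(a in Theta) (excess a * likelihood w a).
    apply/funext => w; rewrite /posterior_mean posterior_Rintegral; last 2 first.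
    - exact: bounded_measurable_excess.
    - exact: excess_ge0.
    congr (_ * _); rewrite powR_inv1; last first.
      by apply: Rintegral_ge0 => a _; exact: expR_ge0.
    by rewrite -[RHS]mul1r -(posterior_normalization w) mulfK//;
      apply: contra_eq_neq (posterior_normalization w) => ->; rewrite mulr0 eq_sym oner_neq0.
  apply: measurable_funM.
    apply: (measurableT_comp (measurable_powR (-1))).
    by have [] := measurable_Rintegral pi mTheta bounded_measurable_likelihood.
  have [] // := @measurable_Rintegral _ _ _ _ _ pi _
    (fun w a => excess a * likelihood w a) mTheta _.
  apply: bounded_measurableM; last exact: bounded_measurable_likelihood.
  exact: (bounded_measurable_comp bounded_measurable_excess measurable_snd).
have [_ [M hM]] := bounded_measurable_excess.
exists M => w; have ie := bounded_measurable_integrable (rho w) measurableT bounded_measurable_excess.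
rewrite (le_trans (le_normr_Rintegral measurableT ie))//.
rewrite -[leRHS](Rintegral_probability_cst (rho w)); apply: le_Rintegral => //.
- apply: bounded_measurable_integrable => //.
  exact: (bounded_measurable_norm bounded_measurable_excess).
- by apply: bounded_measurable_integrable => //; exact: bounded_measurable_cst.
Qed.

(* [U] is a neighbourhood of [a0] on which the empirical excess is almost as
   small as at [a0], and [kappa] measures its prior mass. *)
Context (a0 : T) (U : set T) (mU : measurable U) (UTheta : U `<=` Theta).
Context (eps kappa : R).
Context (Ueps : forall w a, U a ->
  total_excess w a <= total_excess w a0 + #|I|%:R * eps).
Context (Ukappa : expR (- kappa) <= fine (pi U)).

Definition log_evidence_bound (w : W) : R :=
  t * total_excess w a0 + lambda * eps + kappa.

(** The evidence is bounded below by the contribution of [U] alone. *)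
Lemma normalization_le w : c w <= expR (log_evidence_bound w).
Proof.
have cst_int (r : R) : pi.-integrable U (EFin \o cst r).
  by apply: bounded_measurable_integrable => //; exact: bounded_measurable_cst.
have intU := bounded_measurable_integrable pi mU (mlik w).
have evidence : expR (- log_evidence_bound w) <= \int[pi]_(a in Theta) likelihood w a.
  apply: (@le_trans _ _ (\int[pi]_(a in U)
      expR (- (t * total_excess w a0 + lambda * eps)))).
    rewrite Rintegral_cst// /log_evidence_bound opprD expRD.
    by rewrite ler_wpM2l ?expR_ge0.
  apply: (@le_trans _ _ (\int[pi]_(a in U) likelihood w a)).
    apply: (le_Rintegral mU (cst_int _) intU) => a Ua; rewrite ler_expR lerN2.
    by rewrite /lambda -mulrA -mulrDr ler_wpM2l ?(ltW t0)// Ueps.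
  rewrite -lee_fin -!EFin_Rintegral//; apply: ge0_subset_integral => //.
  - by apply/measurable_EFinP/measurable_funTS; case: (mlik w).
  - by move=> a _; rewrite lee_fin expR_ge0.
rewrite -[leRHS]mul1r -(posterior_normalization w) -mulrA ler_peMr ?(ltW (c0 w))//.
rewrite -(expR0 R) -(addNr (log_evidence_bound w)) expRD.
by rewrite ler_wpM2r ?expR_ge0.
Qed.

Definition penalized_evidence (w : W) : R :=
  \int[pi]_(a in Theta) (expR (lambda / 2 * excess a) * likelihood w a).

Lemma bounded_measurable_penalized :
  bounded_measurable (fun p : W * T =>
    expR (lambda / 2 * excess p.2) * likelihood p.1 p.2).
Proof.
apply: bounded_measurableM; last exact: bounded_measurable_likelihood.
apply: bounded_measurable_expR; apply: bounded_measurableZ.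
exact: (bounded_measurable_comp bounded_measurable_excess measurable_snd).
Qed.

(** Integrate [lambda / 2 * excess <= b + exp(lambda / 2 * excess - b) - 1] against
    the posterior with [b = log_evidence_bound w + s]; on the right-hand side the
    normalization [c w] is absorbed by [normalization_le].  A free [s] serves
    both the bound in expectation and the bound in probability. *)
Lemma posterior_mean_le w s :
  lambda / 2 * posterior_mean w <=
  log_evidence_bound w + s + expR (- s) * penalized_evidence w - 1.
Proof.
pose b := log_evidence_bound w + s.
pose e a := expR (lambda / 2 * excess a).
have me : bounded_measurable e.
  by apply: bounded_measurable_expR; apply: bounded_measurableZ;
    exact: bounded_measurable_excess.
have mx : bounded_measurable (fun a => lambda / 2 * excess a).
  by apply: bounded_measurableZ; exact: bounded_measurable_excess.
have cE (r : R) : bounded_measurable (fun a : T => r) by exact: bounded_measurable_cst.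
have int f : bounded_measurable f -> (rho w).-integrable setT (EFin \o f).
  exact: bounded_measurable_integrable.
rewrite -RintegralZl//; last by apply: int; exact: bounded_measurable_excess.
apply: (@le_trans _ _ (\int[rho w]_a ((b - 1) + expR (- b) * e a))).
  apply: le_Rintegral => //; [exact: int| |].
    by apply/int/bounded_measurableD => //; exact: bounded_measurableZ.
  move=> a _; have := expR_ge1Dx (- b + lambda / 2 * excess a).
  by rewrite expRD /e; lra.
rewrite RintegralD//; [|exact/int|exact/int/bounded_measurableZ].
rewrite Rintegral_probability_cst RintegralZl//; last exact/int.
rewrite posterior_Rintegral//; last by move=> a; exact: expR_ge0.
rewrite -/(penalized_evidence w) addrAC lerD2r lerD2l /b opprD expRD.
rewrite [expR (- log_evidence_bound w) * _]mulrC -mulrA ler_wpM2l ?expR_ge0//.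
rewrite mulrA ler_piMl//.
  by apply: Rintegral_ge0 => a _; rewrite mulr_ge0 ?expR_ge0.
by rewrite expRN mulrC ler_pdivrMr ?expR_gt0// mul1r normalization_le.
Qed.

(** After exchanging the integrals, the factor [exp(lambda / 2 * excess)]
    exactly compensates the exponential moment of the sample. *)
Lemma penalized_evidence_le1 : \int[P]_w penalized_evidence w <= 1.
Proof.
pose f (p : W * T) := expR (lambda / 2 * excess p.2) * likelihood p.1 p.2.
have mf : bounded_measurable f := bounded_measurable_penalized.
pose g p := (f p * \1_Theta p.2)%:E.
have mg : measurable_fun setT g.
  apply/measurable_EFinP; apply: measurable_funM; first by case: mf.
  by apply: measurableT_comp => //; exact: measurable_indic.
have g0 p : (0 <= g p)%E by rewrite lee_fin mulr_ge0 ?mulr_ge0 ?expR_ge0 ?indicE.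
rewrite -lee_fin -EFin_Rintegral//; last first.
  exact: (@measurable_Rintegral _ _ _ _ _ pi Theta
    (fun w a => expR (lambda / 2 * excess a) * likelihood w a) mTheta
    bounded_measurable_penalized).
have -> : (\int[P]_w (penalized_evidence w)%:E = \int[P]_w \int[pi]_a g (w, a))%E.
  apply: eq_integral => w _; rewrite -EFin_Rintegral//; last first.
    exact: (bounded_measurableM (bounded_measurable_expR
      (bounded_measurableZ _ bounded_measurable_excess)) (mlik w)).
  rewrite integral_mkcond; apply: eq_integral => a _.
  by rewrite patchE /g indicE; case: ifP => _; rewrite ?mulr1 ?mulr0.
rewrite fubini_tonelli//.
apply: (@le_trans _ _ (\int[pi]_a (cst 1%E a)))%E; last first.
  by rewrite integral_cst// mul1e probability_le1.
apply: ge0_le_integral => //.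
- by move=> a _; apply: integral_ge0.
- exact: measurable_fun_fubini_tonelli_G.
move=> a _; apply: (@le_trans _ _ (\int[P]_w (f (w, a))%:E)%E).
  apply: ge0_le_integral => //.
  - exact: (measurableT_comp mg (measurable_pair2 a)).
  - apply/measurable_EFinP.
    exact: (measurableT_comp mf.1 (measurable_pair2 a)).
  - move=> w _; rewrite lee_fin ler_piMr ?mulr_ge0 ?expR_ge0// indicE; case: (a \in Theta).
have ml : bounded_measurable (likelihood ^~ a).
  exact: (@bounded_measurable_section2 _ _ _ _ _ likelihood a
    bounded_measurable_likelihood).
rewrite EFin_Rintegral//; last first.
  by rewrite /f; exact: (bounded_measurableZ (expR (lambda / 2 * excess a)) ml).
rewrite lee_fin /f /= RintegralZl//; last exact: bounded_measurable_integrable.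
have nt : `|- t| = t by rewrite normrN gtr0_norm.
have := exponential_moment_total a nt.
under eq_Rintegral do rewrite mulNr -/(likelihood _ a).
move=> /(ler_wpM2l (expR_ge0 (lambda / 2 * excess a))) /le_trans; apply.
by rewrite -expRD expR_le1 /lambda le_eqVlt; apply/orP; left; apply/eqP; field.
Qed.

Lemma lambda_gt0 : 0 < lambda.
Proof.
by rewrite mulr_gt0// ltr0n -cardsT card_gt0; apply/set0Pn; exists i0; rewrite inE.
Qed.

(** [posterior_mean_le] with [s = 0]: both the constant [-1] and the penalized
    evidence, of expectation at most one, disappear. *)
Lemma pac_bayes_expectation :
  \int[P]_w posterior_mean w <=
  2 * excess a0 + 2 * eps + 2 * kappa / lambda.
Proof.
have l0 := lambda_gt0.
have mt : bounded_measurable (fun w => t * total_excess w a0).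
  apply: bounded_measurableZ.
  exact: (@bounded_measurable_section2 _ _ _ _ _ total_excess a0
    bounded_measurable_total).
have mpe : bounded_measurable penalized_evidence.
  exact: (@measurable_Rintegral _ _ _ _ _ pi Theta
    (fun w a => expR (lambda / 2 * excess a) * likelihood w a) mTheta
    bounded_measurable_penalized).
have cE (r : R) : bounded_measurable (fun w : W => r) by exact: bounded_measurable_cst.
have int f : bounded_measurable f -> P.-integrable setT (EFin \o f).
  exact: bounded_measurable_integrable.
have mpm := bounded_measurable_posterior_mean.
have h : \int[P]_w (lambda / 2 * posterior_mean w) <=
    \int[P]_w (t * total_excess w a0 + (lambda * eps + kappa - 1) + penalized_evidence w).
  apply: le_Rintegral => //; first exact/int/bounded_measurableZ.
    by apply/int/bounded_measurableD => //; exact: bounded_measurableD.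
  move=> w _; have := posterior_mean_le w 0.
  by rewrite oppr0 expR0 mul1r /log_evidence_bound; lra.
move: h; rewrite RintegralZl//; last exact/int.
rewrite RintegralD//; [|exact/int/bounded_measurableD|exact/int].
rewrite RintegralD//; [|exact/int|exact/int].
rewrite Rintegral_probability_cst RintegralZl//; last first.
  apply: int; exact: (@bounded_measurable_section2 _ _ _ _ _ total_excess a0
    bounded_measurable_total).
rewrite Rintegral_total mulrA -/lambda => h.
have {h} := le_trans h (lerD (lexx _) penalized_evidence_le1).
rewrite -ler_pdivlMl ?divr_gt0// => /le_trans; apply.
by rewrite le_eqVlt; apply/orP; left; apply/eqP; field; rewrite gt_eqF.
Qed.

(** Two events of probability at least [1 - delta / 2] are combined: the
    penalized evidence is at most [2 / delta], and so is [F], which controls the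
    empirical excess at [a0].  The free threshold [r] allows larger bounds to be
    substituted while keeping the event measurable. *)
Lemma pac_bayes_probability (delta r : R) : 0 < delta < 1 ->
  3 * excess a0 + 2 * eps + 2 * kappa / lambda + 4 * ln (2 / delta) / lambda <= r ->
  ((1 - delta)%:E <= P [set w | posterior_mean w <= r]%R)%E.
Proof.
move=> /andP[d0 d1] hr; have l0 := lambda_gt0.
set good := [set w | _].
pose F w := expR (t * total_excess w a0 - 3 / 2 * lambda * excess a0).
have mt : bounded_measurable (total_excess ^~ a0).
  exact: (@bounded_measurable_section2 _ _ _ _ _ total_excess a0
    bounded_measurable_total).
have mE : bounded_measurable (fun w => expR (t * total_excess w a0)).
  by apply: bounded_measurable_expR; exact: bounded_measurableZ.
have FE w : F w = expR (- (3 / 2 * lambda * excess a0)) * expR (t * total_excess w a0).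
  by rewrite /F expRD mulrC.
have mF : bounded_measurable F.
  by rewrite (funext FE); exact: bounded_measurableZ.
have F1 : \int[P]_w F w <= 1.
  under eq_Rintegral do rewrite FE.
  rewrite RintegralZl//; last exact: bounded_measurable_integrable.
  have := exponential_moment_total a0 (gtr0_norm t0).
  move=> /(ler_wpM2l (expR_ge0 (- (3 / 2 * lambda * excess a0)))) /le_trans; apply.
  by rewrite -expRD expR_le1 /lambda le_eqVlt; apply/orP; left; apply/eqP; field.
have mpe : bounded_measurable penalized_evidence.
  exact: (@measurable_Rintegral _ _ _ _ _ pi Theta
    (fun w a => expR (lambda / 2 * excess a) * likelihood w a) mTheta
    bounded_measurable_penalized).
have b0 : 0 < 2 / delta by rewrite divr_gt0.
have pe0 w : 0 <= penalized_evidence w.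
  by apply: Rintegral_ge0 => a _; rewrite mulr_ge0 ?expR_ge0.
have P1 := markov_bounded b0 mpe pe0 penalized_evidence_le1.
have P2 := markov_bounded b0 mF (fun=> expR_ge0 _) F1.
set A1 := [set w | _] in P1; set A2 := [set w | _] in P2.
have mA1 : measurable A1 by apply: measurable_le_set; case: mpe.
have mA2 : measurable A2 by apply: measurable_le_set; case: mF.
have mgood : measurable good.
  by apply: measurable_le_set; case: bounded_measurable_posterior_mean.
have sub : A1 `&` A2 `<=` good.
  move=> w [h1 h2]; rewrite /good/=.
  have h3 : t * total_excess w a0 <= 3 / 2 * lambda * excess a0 + ln (2 / delta).
    by rewrite -lerBlDl -ler_expR lnK ?posrE.
  have := posterior_mean_le w (ln (2 / delta)).
  rewrite expRN lnK ?posrE//.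
  have h4 : (2 / delta)^-1 * penalized_evidence w <= 1.
    by rewrite ler_pdivrMl// mulr1.
  rewrite /log_evidence_bound => h5.
  have : lambda / 2 * posterior_mean w <= lambda / 2 *
     (3 * excess a0 + 2 * eps + 2 * kappa / lambda + 4 * ln (2 / delta) / lambda).
    rewrite [leRHS](_ : _ = 3 / 2 * lambda * excess a0 + lambda * eps + kappa +
      2 * ln (2 / delta)); first by lra.
    by field; rewrite gt_eqF.
  by rewrite ler_pM2l ?divr_gt0// => /le_trans; apply.
have bad : (P (~` good) <= delta%:E)%E.
  apply: (@le_trans _ _ (P (~` A1 `|` ~` A2))).
    apply: le_measure; rewrite ?inE; [exact: measurableC| |].
      by apply: measurableU; exact: measurableC.
    by rewrite -setCI; exact: subsetC.
  apply: (@le_trans _ _ (P (~` A1) + P (~` A2)))%E.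
    by apply: measureU2; exact: measurableC.
  rewrite (le_trans (leeD P1 P2))// -EFinD lee_fin invf_div.
  by rewrite le_eqVlt; apply/orP; left; apply/eqP; field.
rewrite -[good]setCK probability_setC; last exact: measurableC.
by rewrite EFinB leeB.
Qed.

End excess_risk.

(** * Regularity of networks in their parameters *)

Section network_regularity.
Context {R : realType} (d L D : nat).
Implicit Types (theta : param R d L D) (x : d.-tuple R).

Lemma measurable_coefficient (c : coef d L D) :
  measurable_fun setT (fun theta : param R d L D => coefficient theta c).
Proof. exact: measurable_tnth. Qed.

Lemma measurable_bounded_params (B : R) : measurable (bounded_params R d L D B).
Proof.
have -> : bounded_params R d L D B =
    \bigcap_(c in [set: coef d L D]) [set theta | `|coefficient theta c| <= B].
  by apply/seteqP; split=> [theta h c _|theta h c]; exact: h.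
apply: fin_bigcap_measurable => // c _; apply: measurable_le_set.
by apply: measurableT_comp => //; exact: measurable_coefficient.
Qed.

Lemma measurable_activation (phi : R -> R) (l : nat) (hl : (l <= L)%N)
    (i : 'I_(width d L D l)) : measurable_fun setT phi ->
  measurable_fun setT (fun p : param R d L D * d.-tuple R =>
    activation phi p.1 p.2 hl i ord0).
Proof.
move=> mphi; elim: l hl i => [|l IH] hl i.
  under eq_fun do rewrite mxE.
  exact: (measurableT_comp (measurable_tnth i) measurable_snd).
under eq_fun do rewrite /= !mxE.
apply: (measurableT_comp mphi); apply: measurable_funD.
  apply: measurable_sum => j; under eq_fun do rewrite mxE.
  apply: measurable_funM; last exact: IH.
  exact: (measurableT_comp (measurable_coefficient _) measurable_fst).
exact: (measurableT_comp (measurable_coefficient _) measurable_fst).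
Qed.

Lemma measurable_network (hL : (0 < L)%N) (phi : R -> R) :
  measurable_fun setT phi ->
  measurable_fun setT (fun p : param R d L D * d.-tuple R =>
    network hL phi p.1 p.2).
Proof. by move=> mphi; exact: measurable_activation. Qed.

Context (hd : (0 < d)%N) (hD : (d <= D)%N).

Lemma width_le l : (width d L D l <= D)%N.
Proof. by case: l => //= l; case: ifP => // _; exact: leq_trans hd hD. Qed.

(** Each of the [L] layers has at most [D * D] weights and [D <= D * D] biases. *)
Lemma card_coef_le : (#|coef d L D| <= 2 * (L * D ^ 2))%N.
Proof.
rewrite card_tagged sumnE big_map big_enum/=.
apply: (@leq_trans (\sum_(l : 'I_L) (2 * D ^ 2))%N).
  apply: leq_sum => l _; rewrite card_sum card_prod !card_ord.
  have D0 : (0 < D)%N := leq_trans hd hD.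
  have h1 := width_le l; have h2 := width_le l.+1.
  rewrite mul2n -addnn leq_add//; first by rewrite -mulnn leq_mul.
  by rewrite (leq_trans h2)// -mulnn leq_pmulr.
by rewrite sum_nat_const card_ord mulnCA.
Qed.

Context (phi : R -> R) (B eps : R) (hB : 1 <= B) (heps : 0 <= eps).
Context (phi_lip : forall a b, `|phi a - phi b| <= `|a - b|).
Context (phi_le : forall a, `|phi a| <= `|a|).

(* A layer sends inputs of maximum norm at most M, where M >= 1, to outputs of
   maximum norm at most q * M: D weights and one bias, all bounded by B. *)
Local Notation q := (B * (D%:R + 1)).

Let B0 : 0 <= B. Proof. exact: le_trans ler01 hB. Qed.

Let q1 : 1 <= q.
Proof.
by rewrite -[leLHS]mul1r ler_pM// lerDr.
Qed.

Lemma sum_width_le l (F : 'I_(width d L D l) -> R) (M : R) : 0 <= M ->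
  (forall j, F j <= M) -> \sum_j F j <= D%:R * M.
Proof.
move=> M0 FM; apply: (@le_trans _ _ (\sum_(j < width d L D l) M)).
  exact: ler_sum.
rewrite sumr_const card_ord -[leLHS]mulr_natl ler_wpM2r// ler_nat.
exact: width_le.
Qed.

Lemma activation_le theta x l (hl : (l <= L)%N) i :
  theta \in bounded_params R d L D B -> x \in unit_cube R d ->
  `|activation phi theta x hl i ord0| <= q ^+ l.
Proof.
move=> /set_mem htheta /set_mem hx; elim: l hl i => [|l IH] hl i.
  by rewrite mxE expr0 ger0_norm; have /andP[] := hx i.
rewrite /= !mxE (le_trans (phi_le _))// (le_trans (ler_normD _ _))//.
have ql : 1 <= q ^+ l by rewrite exprn_ege1.
have -> : q ^+ l.+1 = D%:R * (B * q ^+ l) + B * q ^+ l by rewrite exprS; ring.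
apply: lerD; last first.
  by rewrite (le_trans (htheta _))// ler_peMr.
rewrite (le_trans (ler_norm_sum _ _ _))//; apply: sum_width_le => [|j].
  by rewrite mulr_ge0// (le_trans _ ql).
by rewrite normrM !mxE ler_pM.
Qed.

(** A perturbation of the coefficients by [eps] adds at each layer at most
    [eps * (D * q ^+ l + 1) <= eps * q ^+ l.+1], and earlier errors are
    amplified by at most [q]; [l] layers thus give [l] terms of size
    [eps * q ^+ l]. *)
Lemma activation_lipschitz theta theta' x l (hl : (l <= L)%N) i :
  theta \in bounded_params R d L D B -> theta' \in bounded_params R d L D B ->
  (forall c, `|coefficient theta c - coefficient theta' c| <= eps) ->
  x \in unit_cube R d ->
  `|activation phi theta x hl i ord0 - activation phi theta' x hl i ord0|
    <= eps * (l%:R * q ^+ l).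
Proof.
move=> ht ht' close hx; have /set_mem htheta := ht.
elim: l hl i => [|l IH] hl i.
  by rewrite !mxE subrr normr0 mul0r mulr0.
rewrite /= !mxE (le_trans (phi_lip _ _))//.
set a := activation phi theta x _ in IH *.
set a' := activation phi theta' x _ in IH *.
rewrite opprD addrACA -sumrB (le_trans (ler_normD _ _))//.
have ql : 1 <= q ^+ l by rewrite exprn_ege1.
have D0 : 0 <= D%:R :> R by [].
have l0 : 0 <= l%:R :> R by [].
apply: (@le_trans _ _ (D%:R * (B * (eps * (l%:R * q ^+ l)) + eps * q ^+ l) + eps)).
  apply: lerD; last exact: close.
  rewrite (le_trans (ler_norm_sum _ _ _))//; apply: sum_width_le => [|j].
    by rewrite addr_ge0// !mulr_ge0// (le_trans _ ql).
  rewrite !mxE.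
  set w := coefficient theta _; set w' := coefficient theta' _.
  have -> : w * a j ord0 - w' * a' j ord0 =
     w * (a j ord0 - a' j ord0) + (w - w') * a' j ord0 by ring.
  rewrite (le_trans (ler_normD _ _))// !normrM; apply: lerD.
    by rewrite ler_pM//; [exact: htheta|exact: IH].
  by rewrite ler_pM//; [exact: close|exact: activation_le].
rewrite -[l.+1]addn1 natrD exprD expr1.
set Q := q ^+ l in ql *; set E := D%:R in D0 *; set M := l%:R in l0 *.
have B1 : 0 <= B - 1 by rewrite subr_ge0.
have Q1 : 0 <= Q - 1 by rewrite subr_ge0.
have Q0 : 0 <= Q by exact: le_trans ql.
have h2 : 0 <= eps * (M * Q * B) by rewrite !mulr_ge0.
have h3 : 0 <= eps * ((B - 1) * (E * Q)) by rewrite !mulr_ge0.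
have h4 : 0 <= eps * (B * (Q - 1)) by rewrite !mulr_ge0.
have h5 : 0 <= eps * (B - 1) by rewrite mulr_ge0.
lra.
Qed.

Lemma network_lipschitz (hL : (0 < L)%N) theta theta' x :
  theta \in bounded_params R d L D B -> theta' \in bounded_params R d L D B ->
  (forall c, `|coefficient theta c - coefficient theta' c| <= eps) ->
  x \in unit_cube R d ->
  `|network hL phi theta x - network hL phi theta' x| <= eps * (L%:R * q ^+ L).
Proof. exact: activation_lipschitz. Qed.
End network_regularity.

(** * Gaussian mass of small boxes and minimizers on the parameter box *)

Section gaussian_mass.
Context {R : realType}.

(** Whatever the position of [a] in [[-B, B]], the set contains an interval of
    length [eps], on the side of [a] that faces zero, where the density is at
    least its value at [B]. *)
Lemma gaussian_interval_mass (B a eps : R) : 1 <= B -> `|a| <= B -> 0 < eps <= 1 ->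
  ((eps * normal_pdf 0 1 B)%:E <=
   normal_prob 0 1 [set x | `|x - a| <= eps /\ `|x| <= B]%R)%E.
Proof.
move=> B1 aB /andP[e0 e1]; pose u := if 0 <= a then a - eps else a.
have sub : `[u, u + eps] `<=` [set x : R | `|x - a| <= eps /\ `|x| <= B].
  move=> x /=; rewrite in_itv/= => /andP[]; move: aB; rewrite /u !ler_norml => /andP[].
  by case: (leP 0 a) => a0 h1 h2 h3 h4; split; apply/andP; split; lra.
have mA : measurable [set x : R | `|x - a| <= eps /\ `|x| <= B].
  apply: measurableI; apply: measurable_le_set.
    by apply: measurableT_comp => //; exact: measurable_funB.
  by [].
have mpdf D : measurable_fun D (fun x : R => (normal_pdf 0 1 x)%:E).
  by apply/measurable_EFinP/measurable_funTS; exact: measurable_normal_pdf.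
pose I := (\int[lebesgue_measure]_(x in `[u, (u + eps)%R]) (normal_pdf 0 1 x)%:E)%E.
have h1 : ((eps * normal_pdf 0 1 B)%:E <= I)%E; last first.
  apply: (le_trans h1); apply: ge0_subset_integral => //; first exact: mpdf.
  by move=> x _; rewrite lee_fin normal_pdf_ge0.
apply: (@le_trans _ _ (\int[lebesgue_measure]_(x in `[u, (u + eps)%R]) (cst (normal_pdf 0 1 B)%:E x))%E).
  rewrite integral_cst//= lebesgue_measure_itv/= lte_fin ltrDl e0.
  by rewrite -EFinD addrAC subrr add0r -EFinM mulrC.
apply: ge0_le_integral => //; [|exact: mpdf|].
  by move=> x _; rewrite lee_fin normal_pdf_ge0.
move=> x /sub[_ xB]; rewrite lee_fin normal_pdfE ?oner_neq0//=.
rewrite ler_wpM2l ?normal_peak_ge0// /normal_fun ler_expR !subr0 !mulNr lerN2.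
rewrite ler_wpM2r ?invr_ge0//.
by rewrite -(real_normK (num_real x)) lerXn2r ?nnegrE//; lra.
Qed.

Lemma normal_pdf_gt0 (x : R) : 0 < normal_pdf 0 1 x.
Proof.
by rewrite normal_pdfE ?oner_neq0//= mulr_gt0 ?normal_peak_gt0 ?expR_gt0 ?oner_neq0.
Qed.

Context (d L D : nat).

(** The constraints bear on one coefficient each, so that the prior mass is a
    product over the coefficients. *)
Definition coefficient_box (B eps : R) (theta0 : param R d L D) : set (param R d L D) :=
  [set theta | forall c, `|coefficient theta c - coefficient theta0 c| <= eps
                      /\ `|coefficient theta c| <= B].

Lemma measurable_coefficient_box B eps theta0 : measurable (coefficient_box B eps theta0).
Proof.
have -> : coefficient_box B eps theta0 = \bigcap_(c in [set: coef d L D])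
    ([set theta | `|coefficient theta c - coefficient theta0 c| <= eps] `&`
     [set theta | `|coefficient theta c| <= B]).
  by apply/seteqP; split=> [theta h c _|theta h c]; exact: h.
apply: fin_bigcap_measurable => // c _.
apply: measurableI; apply: measurable_le_set.
  apply: measurableT_comp => //; apply: measurable_funB => //.
  exact: measurable_coefficient.
by apply: measurableT_comp => //; exact: measurable_coefficient.
Qed.

(** The mass is written as [exp(- kappa)], the form required by the PAC-Bayes
    bound. *)
Lemma prior_box_mass (pi : probability (param R d L D) R) B eps theta0 :
  1 <= B -> 0 < eps <= 1 -> theta0 \in bounded_params R d L D B ->
  standard_gaussian_prior pi ->
  expR (- (#|coef d L D|%:R * - ln (eps * normal_pdf 0 1 B))) <=
  fine (pi (coefficient_box B eps theta0)).
Proof.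
move=> B1 e01 /set_mem h0 [ind gau]; have /andP[e0 _] := e01.
have p0 : 0 < eps * normal_pdf 0 1 B by rewrite mulr_gt0 ?normal_pdf_gt0.
rewrite mulrN opprK expRM_natl lnK ?posrE//.
pose A c := [set x : R | `|x - coefficient theta0 c| <= eps /\ `|x| <= B].
have mA c : measurable (A c).
  apply: measurableI; apply: measurable_le_set.
    by apply: measurableT_comp => //; exact: measurable_funB.
  by [].
have boxE : coefficient_box B eps theta0 =
    \bigcap_(c in [set c | c \in [set: coef d L D]%SET])
      (fun theta : param R d L D => coefficient theta c) @^-1` A c.
  apply/seteqP; split=> [theta h c _|theta h c]; first exact: h.
  by apply: (h c); rewrite /= inE.
have mass c : pi ((fun theta : param R d L D => coefficient theta c) @^-1` A c) =
    (fine (normal_prob 0 1 (A c)))%:E.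
  rewrite (gau c (A c) (mA c)) fineK//.
  by apply: fin_num_measure; exact: mA.
rewrite boxE ind// (eq_bigr _ (fun c _ => mass c)) prodEFin/=.
rewrite -prodr_const (eq_bigl predT); last by move=> c; rewrite inE.
rewrite [leRHS](eq_bigl predT); last by move=> c; rewrite inE.
apply: ler_prod => c _; rewrite (ltW p0)/= -lee_fin fineK.
  exact: gaussian_interval_mass.
by apply: fin_num_measure; exact: mA.
Qed.
End gaussian_mass.

Section box_minimum.
Context {R : realType} (d L D : nat).

(** Composing with the coordinatewise clamp to [[-B, B]] turns a function that
    is Lipschitz on the box into one that is continuous everywhere. *)
Lemma lipschitz_box_min (B Lambda : R) (g : param R d L D -> R) :
  0 <= B -> 0 <= Lambda ->
  (forall eps theta theta', 0 <= eps ->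
    theta \in bounded_params R d L D B -> theta' \in bounded_params R d L D B ->
    (forall c, `|coefficient theta c - coefficient theta' c| <= eps) ->
    `|g theta - g theta'| <= Lambda * eps) ->
  exists2 theta0, theta0 \in bounded_params R d L D B &
    forall theta, theta \in bounded_params R d L D B -> g theta0 <= g theta.
Proof.
move=> B0 L0 glip; pose N := #|coef d L D|.
pose clamp (r : R) := Num.max (- B) (Num.min B r).
have clampB r : `|clamp r| <= B.
  by rewrite ler_norml /clamp le_max lexx/= ge_max ge_min lexx/= andbT; lra.
have clamp_id r : `|r| <= B -> clamp r = r.
  by rewrite ler_norml /clamp => /andP[h1 h2]; rewrite min_r// max_r.
have max_lip (a r s : R) : `|Num.max a r - Num.max a s| <= `|r - s|.
  have m1 := ler_norm (r - s); have m2 := ler_norm (s - r).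
  rewrite distrC in m2; rewrite ler_norml !maxEle.
  by case: (lerP a r) => ?; case: (lerP a s) => ?; apply/andP; split; lra.
have min_lip (a r s : R) : `|Num.min a r - Num.min a s| <= `|r - s|.
  have m1 := ler_norm (r - s); have m2 := ler_norm (s - r).
  rewrite distrC in m2; rewrite ler_norml !minEle.
  by case: (lerP a r) => ?; case: (lerP a s) => ?; apply/andP; split; lra.
have clamp_lip r s : `|clamp r - clamp s| <= `|r - s|.
  exact: le_trans (max_lip _ _ _) (min_lip _ _ _).
pose decode (v : 'rV[R]_N) : param R d L D := [tuple clamp (v ord0 i) | i < N].
have decodeE v c : coefficient (decode v) c = clamp (v ord0 (enum_rank c)).
  by rewrite /coefficient tnth_mktuple.
have decodeB v : decode v \in bounded_params R d L D B.
  by apply/mem_set => c; rewrite decodeE.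
have cont : continuous (g \o decode).
  move=> v; apply/(@cvgrPdist_le R R^o _ (nbhs v) (nbhs_filter v)) => e e0 /=.
  have L1 : 0 < Lambda + 1 by lra.
  have d0 : 0 < e / (Lambda + 1) by rewrite divr_gt0.
  apply/nbhs_ballP; exists (e / (Lambda + 1)) => //= v' [_ close].
  apply: (le_trans (glip (e / (Lambda + 1)) _ _ (ltW d0) (decodeB _) (decodeB _) _)).
    move=> c; rewrite !decodeE (le_trans (clamp_lip _ _))// ltW//.
    exact: (close ord0 (enum_rank c)).
  by rewrite mulrCA ler_piMr ?(ltW e0)// ler_pdivrMr// mul1r lerDl.
have cpt : compact [set v : 'rV[R]_N | forall i, `[- B, B]%classic (v ord0 i)].
  by apply: (@rV_compact _ _ (fun=> `[- B, B]%classic)) => _; exact: segment_compact.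
have [|v _ vmin] := EVT_min_rV _ cpt (continuous_subspaceT cont).
  by exists 0 => i /=; rewrite mxE in_itv/=; lra.
exists (decode v) => // theta /set_mem htheta.
pose v' : 'rV[R]_N := \row_i tnth theta i.
have : g (decode v) <= g (decode v').
  apply: vmin; apply/mem_set => i /=; rewrite mxE in_itv/= -ler_norml.
  by have := htheta (enum_val i); rewrite /coefficient enum_valK.
congr (_ <= g _); apply: eq_from_tnth => i.
rewrite tnth_mktuple mxE clamp_id//.
by have := htheta (enum_val i); rewrite /coefficient enum_valK.
Qed.
End box_minimum.

(** * The logistic model as an instance of the PAC-Bayes bound *)

Section logistic_model.
Context {R : realType} (d n L D : nat).
Context (hn : (0 < n)%N) (hL : (0 < L)%N) (hd : (0 < d)%N) (hD : (d <= D)%N).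
Context (phi : R -> R) (dW : measure_display) (W : measurableType dW).
Context (P : probability W R) (Y : 'I_n -> W -> R) (X : 'I_n -> W -> d.-tuple R).
Context (f0 : d.-tuple R -> R) (B C K : R).
Context (hB : 1 <= B) (hC : 1 <= C) (hK : 0 < K).
Context (sample : logistic_sample P Y X f0).
Context (phi_lip : forall a b, `|phi a - phi b| <= `|a - b|).
Context (phi_le : forall a, `|phi a| <= `|a|).

Local Notation Theta := (bounded_params R d L D B).
Local Notation f := (fun theta : param R d L D => network hL phi theta).
Local Notation S := (R * d.-tuple R)%type.
Local Notation i0 := (Ordinal hn).
Local Notation q := (B * (D%:R + 1)).

Context (f0C : (sup_norm f0 <= C%:E)%E).
Context (fC : forall theta, theta \in Theta -> (sup_norm (f theta) <= C%:E)%E).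

Lemma sup_norm_le (g : d.-tuple R -> R) x :
  (sup_norm g <= C%:E)%E -> x \in unit_cube R d -> `|g x| <= C.
Proof.
move=> gC /set_mem hx; rewrite -lee_fin (le_trans _ gC)//.
by apply: ereal_sup_ubound; exists x.
Qed.

Lemma measurable_unit_cube : measurable (unit_cube R d).
Proof.
have -> : unit_cube R d = \bigcap_(i in [set: 'I_d])
    ((fun x : d.-tuple R => tnth x i) @^-1` `[0, 1]%classic).
  apply/seteqP; split=> [x h i _|x h i]; first by rewrite /= in_itv/=; exact: h.
  by have := h i I; rewrite /= in_itv.
apply: fin_bigcap_measurable => // i _.
by rewrite -[X in measurable X]setTI; exact: measurable_tnth.
Qed.

Lemma measurable_activation_function : measurable_fun setT phi.
Proof.
apply: continuous_measurable_fun => x; apply/(@cvgrPdist_le R R^o) => e e0.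
apply/nbhs_ballP; exists e => //= y /ltW; exact: le_trans.
Qed.

Definition labelled_cube : set S :=
  [set s | (s.1 = -1 \/ s.1 = 1) /\ s.2 \in unit_cube R d].

Lemma measurable_labelled_cube : measurable labelled_cube.
Proof.
have -> : labelled_cube = (([set -1] `|` [set 1]) `*` unit_cube R d : set S).
  apply/seteqP; split=> -[y x] /= [hy hx]; split=> //; first exact: set_mem.
  exact: mem_set.
apply: measurableX; last exact: measurable_unit_cube.
by apply: measurableU; exact: measurable_set1.
Qed.

(** The excess loss, cut off outside the box of parameters and outside the
    sample space, so that its bounds and measurability hold everywhere. *)
Definition excess_loss (theta : param R d L D) (s : S) : R :=
  \1_Theta theta * \1_labelled_cube s *
  (loss s.1 (f theta s.2) - loss s.1 ((f0 \_ (unit_cube R d)) s.2)).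

Lemma measurable_excess_loss :
  measurable_fun setT (fun p : param R d L D * S => excess_loss p.1 p.2).
Proof.
have mphi := measurable_activation_function.
have m1 : measurable_fun setT (fun p : param R d L D * S => p.2.1).
  exact: (measurableT_comp measurable_fst measurable_snd).
have m2 : measurable_fun setT (fun p : param R d L D * S => p.2.2).
  exact: (measurableT_comp measurable_snd measurable_snd).
apply: measurable_funM.
  apply: measurable_funM.
    apply: measurableT_comp => //; apply: measurable_indic.
    exact: measurable_bounded_params.
  apply: measurableT_comp => //; apply: measurable_indic.
  exact: measurable_labelled_cube.
apply: measurable_funB.
  apply: (measurableT_comp (@measurable_loss R)
    (g := fun p : param R d L D * S => (p.2.1, f p.1 p.2.2))).
  apply: measurable_fun_pair => //.
  exact: (measurableT_comp (measurable_network hL mphi)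
    (measurable_fun_pair measurable_fst m2)).
apply: (measurableT_comp (@measurable_loss R)
  (g := fun p : param R d L D * S => (p.2.1, (f0 \_ (unit_cube R d)) p.2.2))).
apply: measurable_fun_pair => //.
apply: (measurableT_comp _ m2).
apply/(measurable_restrictT _ measurable_unit_cube).
exact: logistic_measurable_f0 sample.
Qed.

Lemma excess_loss_le theta s : `|excess_loss theta s| <= C.
Proof.
rewrite /excess_loss !indicE.
case: (boolP (theta \in Theta)) => ht; last by rewrite !mul0r normr0 (le_trans ler01).
case: (boolP (s \in labelled_cube)) => hs; last by rewrite mulr0 !mul0r normr0 (le_trans ler01).
rewrite !mul1r; have /set_mem [hy hx] := hs.
apply: loss_oscillation => //; first exact: (sup_norm_le (fC ht)).
by rewrite patchE hx; exact: sup_norm_le.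
Qed.

Definition observation (i : 'I_n) (w : W) : S := (Y i w, X i w).

Lemma measurable_observation i : measurable_fun setT (observation i).
Proof.
apply: measurable_fun_pair.
  exact: logistic_measurable_label sample i.
exact: logistic_measurable_input sample i.
Qed.

Lemma excess_loss_out theta s : theta \notin Theta -> excess_loss theta s = 0.
Proof. by rewrite /excess_loss indicE => /negPf ->; rewrite !mul0r. Qed.

Lemma excess_loss_observation theta i w : theta \in Theta ->
  excess_loss theta (observation i w) =
  loss (Y i w) (f theta (X i w)) - loss (Y i w) (f0 (X i w)).
Proof.
move=> ht; rewrite /excess_loss !indicE ht mul1r mem_set; last first.
  by split; [exact: logistic_label sample i w|exact: logistic_input sample i w].
by rewrite mul1r patchE (logistic_input sample i w).
Qed.

Local Notation excessR := (excess P i0 observation excess_loss).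

Lemma bounded_measurable_loss i (g : d.-tuple R -> R) :
  measurable_fun (unit_cube R d) g -> (sup_norm g <= C%:E)%E ->
  bounded_measurable (fun w => loss (Y i w) (g (X i w))).
Proof.
move=> mg gC; split.
  have -> : (fun w => loss (Y i w) (g (X i w))) =
      (fun p : R * R => loss p.1 p.2) \o
      (fun w => (Y i w, (g \_ (unit_cube R d)) (X i w))).
    by apply/funext => w /=; rewrite patchE (logistic_input sample i w).
  apply: (measurableT_comp (@measurable_loss R)).
  apply: measurable_fun_pair; first exact: logistic_measurable_label sample i.
  apply: (measurableT_comp _ (logistic_measurable_input sample i)).
  exact/(measurable_restrictT _ measurable_unit_cube).
exists (ln 2 + C) => w.
have -> : loss (Y i w) (g (X i w)) =
    loss (Y i w) 0 + (loss (Y i w) (g (X i w)) - loss (Y i w) 0) by rewrite addrC subrK.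
rewrite (le_trans (ler_normD _ _))// lerD//.
  by rewrite /loss mulr0 oppr0 expR0 ger0_norm// ln_ge0// lerDl.
rewrite (le_trans (loss_lipschitz _ _ (logistic_label sample i w)))// subr0.
exact: (sup_norm_le gC (logistic_input sample i w)).
Qed.

Lemma measurable_network_input theta : measurable_fun (unit_cube R d) (f theta).
Proof.
apply: measurable_funTS.
exact: (measurableT_comp (measurable_network hL measurable_activation_function)
  (measurable_pair1 theta)).
Qed.

Definition real_risk (g : d.-tuple R -> R) : R :=
  \int[P]_w loss (Y i0 w) (g (X i0 w)).

Lemma riskE (g : d.-tuple R -> R) :
  measurable_fun (unit_cube R d) g -> (sup_norm g <= C%:E)%E ->
  risk P Y X hn g = (real_risk g)%:E.
Proof.
move=> mg gC; rewrite /risk unlock EFin_Rintegral//.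
exact: bounded_measurable_loss.
Qed.

Lemma risk_network theta : theta \in Theta ->
  risk P Y X hn (f theta) = (real_risk (f theta))%:E.
Proof.
by move=> ht; apply: riskE; [exact: measurable_network_input|exact: fC].
Qed.

Lemma risk_f0 : risk P Y X hn f0 = (real_risk f0)%:E.
Proof. by apply: riskE => //; exact: logistic_measurable_f0 sample. Qed.

Lemma excessE theta : theta \in Theta ->
  excessR theta = real_risk (f theta) - real_risk f0.
Proof.
move=> ht; rewrite -RintegralB//; last 2 first.
- apply: bounded_measurable_integrable => //; apply: bounded_measurable_loss.
    exact: measurable_network_input.
  exact: fC.
- apply: bounded_measurable_integrable => //; apply: bounded_measurable_loss => //.
  exact: logistic_measurable_f0 sample.
by apply: eq_Rintegral => w _; rewrite excess_loss_observation.
Qed.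

Lemma excess_out theta : theta \notin Theta -> excessR theta = 0.
Proof.
move=> ht; rewrite /excess; under eq_Rintegral do rewrite excess_loss_out//.
exact: Rintegral_probability_cst.
Qed.

Lemma excess_loss_close eps theta theta' i w : 0 <= eps ->
  theta \in Theta -> theta' \in Theta ->
  (forall c, `|coefficient theta c - coefficient theta' c| <= eps) ->
  `|excess_loss theta (observation i w) - excess_loss theta' (observation i w)|
    <= eps * (L%:R * q ^+ L).
Proof.
move=> e0 ht ht' close; rewrite !excess_loss_observation//.
rewrite opprB addrA subrK.
rewrite (le_trans (loss_lipschitz _ _ (logistic_label sample i w)))//.
by apply: network_lipschitz => //; exact: logistic_input sample i w.
Qed.

Let bmz theta := @bounded_measurable_in_sample _ _ _ _ _ _ _ _ _ excess_loss C
  measurable_observation measurable_excess_loss excess_loss_le i0 theta.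

(** The excess risk inherits the Lipschitz constant of the network, because the
    logistic loss is 1-Lipschitz. *)
Lemma exists_risk_minimizer :
  exists2 theta0, theta0 \in Theta &
    forall theta, theta \in Theta -> excessR theta0 <= excessR theta.
Proof.
have B0 : 0 <= B by exact: le_trans ler01 hB.
apply: (@lipschitz_box_min _ _ _ _ _ (L%:R * q ^+ L)) => //.
  by rewrite mulr_ge0// exprn_ge0// mulr_ge0.
move=> eps theta theta' e0 ht ht' close.
rewrite -RintegralB//; [|exact: bounded_measurable_integrable..].
have bmd : bounded_measurable (fun w => excess_loss theta (observation i0 w) -
    excess_loss theta' (observation i0 w)).
  by apply: bounded_measurableD => //; exact: bounded_measurableN.
rewrite (le_trans (le_normr_Rintegral _ _))//; first exact: bounded_measurable_integrable.
rewrite -[leRHS](Rintegral_probability_cst P).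
apply: le_Rintegral => //.
- apply: bounded_measurable_integrable => //; exact: bounded_measurable_norm.
- apply: bounded_measurable_integrable => //; exact: bounded_measurable_cst.
- by move=> w _; rewrite mulrC; exact: excess_loss_close.
Qed.

Context (t lam : R) (t0 : 0 < t) (tC : t * C <= 1) (tK : t * K <= 2^-1).
Context (lamE : lam = t * n%:R).
Context (pi : probability (param R d L D) R) (rho : W -> probability (param R d L D) R).
Context (bernstein : forall i theta, theta \in Theta ->
  ('E_P[fun w => ((loss (Y i w) (f theta (X i w)) - loss (Y i w) (f0 (X i w))) ^+ 2)%R]
   <= K%:E * (risk P Y X hn (f theta) - risk P Y X hn f0))%E).
Context (prior : standard_gaussian_prior pi).
Context (gibbs : forall w, gibbs_posterior pi Theta lam
  (fun theta => empirical_risk Y X w (f theta)) (rho w)).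

Lemma excess_bernstein theta :
  \int[P]_w (excess_loss theta (observation i0 w)) ^+ 2 <= K * excessR theta.
Proof.
case: (boolP (theta \in Theta)) => ht; last first.
  rewrite excess_out// mulr0; under eq_Rintegral do rewrite excess_loss_out// expr0n/=.
  by rewrite Rintegral_probability_cst.
have := bernstein i0 ht; rewrite risk_network// risk_f0 -EFinB -EFinM -excessE//.
rewrite unlock -lee_fin; apply: le_trans; rewrite le_eqVlt; apply/orP; left; apply/eqP.
rewrite -EFin_Rintegral//; last exact: (bounded_measurableM (bmz theta) (bmz theta)).
by apply: eq_integral => w _; rewrite excess_loss_observation.
Qed.

Local Notation total := (total_excess observation excess_loss).
Local Notation likelihoodR := (likelihood observation excess_loss t).

(** The Gibbs posterior is defined with losses; replacing them by excess losses
    multiplies the density by a factor that does not depend on [theta]. *)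
Lemma exists_excess_normalization : exists c : W -> R, (forall w, 0 < c w) /\
  forall w A, measurable A ->
    rho w A = (\int[pi]_(theta in A `&` Theta) (c w * likelihoodR w theta)%:E)%E.
Proof.
have /choice[c hc] : forall w, exists c : R, 0 < c /\ forall A, measurable A ->
    rho w A = (\int[pi]_(theta in A `&` Theta) (c * likelihoodR w theta)%:E)%E.
  move=> w; have [c c0 hc] := gibbs w.
  pose base := \sum_i loss (Y i w) (f0 (X i w)).
  exists (c * expR (- (t * base))); split; first by rewrite mulr_gt0// expR_gt0.
  move=> A mA; rewrite (hc _ mA); apply: eq_integral => theta /set_mem[_ ht].
  rewrite -mulrA /likelihood -expRD; congr (_ * expR _)%:E.
  have -> : total w theta = \sum_i loss (Y i w) (f theta (X i w)) - base.
    rewrite /base -sumrB; apply: eq_bigr => i _.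
    by rewrite excess_loss_observation//; exact/mem_set.
  rewrite /empirical_risk lamE; have n0 : n%:R != 0 :> R by rewrite pnatr_eq0 -lt0n.
  by field.
by exists c; split=> w; have [] := hc w.
Qed.

Context (theta0 : param R d L D) (ht0 : theta0 \in Theta) (eps : R) (e01 : 0 < eps <= 1).

Local Notation kappa := (#|coef d L D|%:R * - ln (eps * normal_pdf 0 1 B)).
Local Notation slack := (eps * (L%:R * q ^+ L)).

Lemma total_excess_box_le w theta : coefficient_box B eps theta0 theta ->
  total w theta <= total w theta0 + #|'I_n|%:R * slack.
Proof.
move=> h; rewrite card_ord -lerBlDl -sumrB.
apply: (@le_trans _ _ (\sum_(i < n) slack)); last by rewrite sumr_const card_ord -[leLHS]mulr_natl.
apply: ler_sum => i _; rewrite (le_trans (ler_norm _))//.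
have [e0 _] := andP e01; apply: excess_loss_close => //; first exact: ltW.
  by apply/mem_set => c; have [] := h c.
by move=> c; have [] := h c.
Qed.

Lemma coefficient_box_sub : coefficient_box B eps theta0 `<=` Theta.
Proof. by move=> theta h c; have [] := h c. Qed.

Let pmean w := posterior_mean P i0 observation excess_loss rho w.

Lemma posterior_box_mass w : rho w Theta = 1%E.
Proof.
have mT : measurable Theta by exact: measurable_bounded_params.
have [c [c0 hc]] := exists_excess_normalization.
have rT : rho w setT = 1%E by exact: probability_setT.
by rewrite -rT !hc// setTI setIid.
Qed.

Let bme := bounded_measurable_excess P i0 measurable_observation
  measurable_excess_loss excess_loss_le.

Lemma posterior_riskE w :
  (\int[rho w]_(theta in Theta) risk P Y X hn (f theta))%E =
  (pmean w + real_risk f0)%:E.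
Proof.
have mT : measurable Theta by exact: measurable_bounded_params.
transitivity (\int[rho w]_(theta in Theta) (excessR theta + real_risk f0)%:E)%E.
  apply: eq_integral => theta ht; rewrite risk_network//.
  by rewrite excessE// subrK.
have cE (r : R) : bounded_measurable (fun theta : param R d L D => r).
  exact: bounded_measurable_cst.
rewrite EFin_Rintegral//; last exact: bounded_measurableD.
rewrite RintegralD//; [|exact: bounded_measurable_integrable..].
congr (_ + _)%:E; last first.
  by rewrite Rintegral_cst//= posterior_box_mass mulr1.
rewrite Rintegral_mkcond; apply: eq_Rintegral => theta _.
by rewrite patchE; case: ifPn => // ht; rewrite excess_out.
Qed.

Lemma gibbs_risk_expectation :
  ((\int[P]_w \int[rho w]_(theta in Theta) risk P Y X hn (f theta)) - risk P Y X hn f0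
   <= 2%:E * (risk P Y X hn (f theta0) - risk P Y X hn f0)
      + (2 * slack + 2 * kappa / lam)%R%:E)%E.
Proof.
have mT : measurable Theta by exact: measurable_bounded_params.
have [c [c0 hc]] := exists_excess_normalization.
have := @pac_bayes_expectation _ _ _ _ _ _ _ P _ i0 observation excess_loss C K t.
move=> /(_ measurable_observation (logistic_independent sample) (logistic_identical sample)).
move=> /(_ measurable_excess_loss excess_loss_le hK t0 tC tK excess_bernstein).
move=> /(_ pi Theta mT rho c c0 hc theta0 _ (measurable_coefficient_box _ _ _) coefficient_box_sub).
move=> /(_ _ _ total_excess_box_le (prior_box_mass hB e01 ht0 prior)).
rewrite card_ord -lamE => h.
have bmp : bounded_measurable pmean.
  exact: (bounded_measurable_posterior_mean measurable_observation
    measurable_excess_loss excess_loss_le hK excess_bernstein mT c0 hc).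
under eq_integral do rewrite posterior_riskE.
rewrite EFin_Rintegral//; last first.
  by apply: bounded_measurableD => //; exact: bounded_measurable_cst.
rewrite risk_network// risk_f0 -!EFinB -EFinM -EFinD lee_fin -excessE//.
rewrite RintegralD//; last 2 first.
- exact: bounded_measurable_integrable.
- by apply: bounded_measurable_integrable => //; exact: bounded_measurable_cst.
by rewrite Rintegral_probability_cst addrK addrA.
Qed.

(** The event has to be measurable for its probability to be bounded below, so
    the upper bounds [a] and [b] are part of the event from the start. *)
Lemma gibbs_risk_probability (delta a b : R) : 0 < delta < 1 ->
  2 * slack + 2 * kappa / lam <= a -> 4 * ln (2 / delta) / lam <= b ->
  (P [set w | \int[rho w]_(theta in Theta) risk P Y X hn (f theta) - risk P Y X hn f0
     <= 3%:E * (risk P Y X hn (f theta0) - risk P Y X hn f0) + a%:E + b%:E]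
   >= (1 - delta)%R%:E)%E.
Proof.
move=> hdelta ha hb; have mT : measurable Theta by exact: measurable_bounded_params.
have [c [c0 hc]] := exists_excess_normalization.
have := @pac_bayes_probability _ _ _ _ _ _ _ P _ i0 observation excess_loss C K t.
move=> /(_ measurable_observation (logistic_independent sample) (logistic_identical sample)).
move=> /(_ measurable_excess_loss excess_loss_le hK t0 tC tK excess_bernstein).
move=> /(_ pi Theta mT rho c c0 hc theta0 _ (measurable_coefficient_box _ _ _) coefficient_box_sub).
move=> /(_ _ _ total_excess_box_le (prior_box_mass hB e01 ht0 prior) delta).
move=> /(_ (3 * excessR theta0 + a + b) hdelta).
rewrite card_ord -lamE => h.
rewrite (_ : [set w | _] = [set w | pmean w <= 3 * excessR theta0 + a + b]).
  by apply: h; rewrite lerD// -addrA lerD2l.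
apply/seteqP; split=> w /=;
  rewrite posterior_riskE risk_network// risk_f0 -!EFinB -EFinM -!EFinD lee_fin -excessE//;
  by rewrite addrK.
Qed.

End logistic_model.

(** * The rate of convergence *)

Section rates.
Context {R : realType}.
Implicit Types (n : nat) (beta delta : R).

Lemma ln_nat_bounds n : (1 < n)%N ->
  [/\ 0 < ln 2 :> R, ln 2 <= ln n%:R :> R & ln n%:R <= n%:R :> R].
Proof.
move=> n1; have n0 : 0 < n%:R :> R by rewrite ltr0n ltnW.
split; first by rewrite ln_gt0// ltr1n.
  by rewrite ler_ln ?posrE// ler_nat.
exact/ltW/ln_sublinear.
Qed.

(** With [x = n / ln n >= 1], the three quantities are the powers of [x] with
    exponents [d / (4 (beta + d))], [d / (beta + d) - 1 = - beta / (beta + d)] and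
    [-1], which are compared through their exponents. *)
Lemma rate_powers (d n : nat) beta : (0 < d)%N -> 0 < beta -> (1 < n)%N ->
  let rate := (n%:R / ln n%:R) `^ (d%:R / (4 * (beta + d%:R))) in
  let psi := (ln n%:R / n%:R) `^ (beta / (beta + d%:R)) in
  [/\ rate <= n%:R / ln n%:R, rate ^+ 4 * (ln n%:R / n%:R) = psi
    & ln n%:R / n%:R <= psi].
Proof.
move=> d0 b0 n1 rate psi; have [l2 l2n lnn] := ln_nat_bounds n1.
have n0 : 0 < n%:R :> R by rewrite ltr0n ltnW.
have ln0 : 0 < ln n%:R :> R by exact: lt_le_trans l2n.
have dR : 0 < d%:R :> R by rewrite ltr0n.
pose x : R := n%:R / ln n%:R.
have x0 : 0 < x by rewrite divr_gt0.
have x1 : 1 <= x by rewrite ler_pdivlMr// mul1r.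
have xV : ln n%:R / n%:R = x `^ (-1) by rewrite powR_inv1 ?(ltW x0)// invf_div.
have s0 : 0 < beta + d%:R by rewrite addr_gt0.
have sN0 : beta + d%:R != 0 by rewrite gt_eqF.
split.
- rewrite -[leRHS]powRr1 ?(ltW x0)//; apply: ler_powR => //.
  by rewrite ler_pdivrMr ?mulr_gt0// mul1r; lra.
- rewrite /psi xV -/x -powR_mulrn ?powR_ge0// -!powRrM -powRD; last by rewrite (gt_eqF x0) implybT.
  by congr (_ `^ _); field.
- rewrite /psi xV -/x -powRrM; apply: ler_powR => //.
  by rewrite mulN1r lerN2 ler_pdivrMr// mul1r lerDl ltW.
Qed.

(** The logarithm of the inverse prior mass is at most the number of
    coefficients, [2 * L * D^2], times [cK * L * ln n].  The bound [L * ln n] comes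
    from [ln q ^+ L = L * ln q] and [ln D = O(ln n)]; the remaining terms
    [ln n], [ln L] and [ln p] are absorbed because [L >= 1] and
    [k * ln n >= 1]. *)
Lemma complexity_le_rate (d : nat) (beta cL cD B p M : R) :
  (0 < d)%N -> 0 < beta -> 0 < cL -> 0 < cD -> 1 <= B -> 0 < p -> 0 < M ->
  exists2 H : R, 0 < H & forall n L D : nat,
  (1 < n)%N -> (0 < L)%N -> (d <= D)%N ->
  let rate := (n%:R / ln n%:R) `^ (d%:R / (4 * (beta + d%:R))) in
  let psi := (ln n%:R / n%:R) `^ (beta / (beta + d%:R)) in
  let Lambda := L%:R * (B * (D%:R + 1)) ^+ L in
  L%:R <= cL * rate -> D%:R <= cD * rate ->
  2 * n%:R^-1 + 2 * (#|coef d L D|%:R * - ln ((n%:R * Lambda)^-1 * p)) / (n%:R / M)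
    <= H * psi.
Proof.
move=> d0 b0 cL0 cD0 B1 p0 M0.
pose k : R := (ln 2)^-1.
have k0 : 0 < k by rewrite invr_gt0 ln_gt0// ltr1n.
pose cq := ln B + ln 2 + `|ln (cD * k)|.
have lnB : 0 <= ln B by exact: ln_ge0.
have ln2 : 0 < ln 2 :> R by rewrite ln_gt0// ltr1n.
have cq0 : 0 <= cq by rewrite !addr_ge0// ltW.
pose cK := 1 + k + k * `|ln p| + (1 + k * cq).
have cK0 : 0 < cK.
  have := mulr_ge0 (ltW k0) (normr_ge0 (ln p)); have := mulr_ge0 (ltW k0) cq0.
  by rewrite /cK; lra.
exists (2 * k + 4 * M * cK * (cL * cD) ^+ 2).
  by rewrite addr_gt0 ?mulr_gt0 ?exprn_gt0 ?mulr_gt0.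
move=> n L D n1 L0 dD rate psi Lambda hL hD.
have [_ l2n lnn] := ln_nat_bounds n1.
have [rate_le rate4 psi_ge] := rate_powers d0 b0 n1.
rewrite -/rate -/psi in rate_le rate4 psi_ge.
have n0 : 0 < n%:R :> R by rewrite ltr0n ltnW.
have D0 : (0 < D)%N by exact: leq_trans dD.
have LR : 1 <= L%:R :> R by rewrite ler1n.
have DR : 1 <= D%:R :> R by rewrite ler1n.
have DR0 : 0 < D%:R :> R by rewrite ltr0n.
have LR0 : 0 < L%:R :> R by rewrite ltr0n.
have B0 : 0 < B by lra.
pose l : R := ln n%:R.
have l0 : 0 < l by exact: lt_le_trans ln2 l2n.
have kl : 1 <= k * l by rewrite /k ler_pdivlMl// mulr1.
have q0 : 0 < B * (D%:R + 1) by rewrite mulr_gt0 ?addr_gt0.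
have Lam0 : 0 < Lambda by rewrite mulr_gt0 ?exprn_gt0.
have rate0 : 0 <= rate by exact: powR_ge0.
have lnD : ln D%:R <= `|ln (cD * k)| + l.
  have Dn : D%:R <= (cD * k) * n%:R.
    rewrite (le_trans hD)// -mulrA ler_wpM2l ?(ltW cD0)// (le_trans rate_le)//.
    by rewrite mulrC ler_wpM2r ?(ltW n0)// /k lef_pV2// posrE.
  apply: (@le_trans _ _ (ln (cD * k * n%:R))); first by rewrite ler_ln ?posrE ?mulr_gt0.
  rewrite lnM ?posrE ?mulr_gt0// lerD2r.
  exact: ler_norm.
have lnq : ln (B * (D%:R + 1)) <= (1 + k * cq) * l.
  rewrite lnM ?posrE ?addr_gt0//.
  have : ln (D%:R + 1) <= ln 2 + ln D%:R :> R.
    by rewrite -lnM ?posrE ?ler_ln ?posrE ?mulr_gt0 ?addr_gt0//; lra.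
  have : cq <= k * l * cq by rewrite ler_peMl.
  rewrite /cq; lra.
have costE : - ln ((n%:R * Lambda)^-1 * p) =
    l + ln L%:R + L%:R * ln (B * (D%:R + 1)) - ln p.
  have nL0 : 0 < n%:R * Lambda by rewrite mulr_gt0.
  have -> : ln ((n%:R * Lambda)^-1 * p) = - ln (n%:R * Lambda) + ln p.
    by rewrite [LHS]lnM ?posrE ?invr_gt0// lnV ?posrE.
  have -> : ln (n%:R * Lambda) = l + ln Lambda by rewrite lnM ?posrE.
  have -> : ln Lambda = ln L%:R + L%:R * ln (B * (D%:R + 1)).
    by rewrite /Lambda [LHS]lnM ?posrE ?exprn_gt0// lnXn// mulr_natl.
  by ring.
have lnL : ln L%:R <= L%:R * (k * l).
  rewrite (le_trans (ltW (ln_sublinear _)))//.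
  by rewrite ler_peMr// ltW.
have cost : - ln ((n%:R * Lambda)^-1 * p) <= cK * (L%:R * l).
  rewrite costE.
  have h1 : l <= L%:R * l by rewrite ler_peMl// ltW.
  have h2 : - ln p <= `|ln p| * (L%:R * (k * l)).
    rewrite (le_trans (y := `|ln p|))//; first by rewrite -normrN ler_norm.
    by rewrite ler_peMr// (le_trans LR)// ler_peMr// ltW.
  have h3 : L%:R * ln (B * (D%:R + 1)) <= L%:R * ((1 + k * cq) * l).
    by rewrite ler_wpM2l// ltW.
  rewrite /cK; lra.
have card : #|coef d L D|%:R <= 2 * (L%:R * D%:R ^+ 2) :> R.
  by rewrite -natrX -!natrM ler_nat card_coef_le.
have kappa_le : #|coef d L D|%:R * - ln ((n%:R * Lambda)^-1 * p) <=
    2 * cK * ((cL * cD) ^+ 2 * (rate ^+ 4 * l)).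
  apply: (@le_trans _ _ (2 * (L%:R * D%:R ^+ 2) * (cK * (L%:R * l)))).
    apply: (le_trans (ler_wpM2l _ cost)) => //.
    by rewrite ler_wpM2r// !mulr_ge0// ltW.
  have -> : 2 * (L%:R * D%:R ^+ 2) * (cK * (L%:R * l)) =
      2 * cK * l * (L%:R ^+ 2 * D%:R ^+ 2) by ring.
  have -> : 2 * cK * ((cL * cD) ^+ 2 * (rate ^+ 4 * l)) =
      2 * cK * l * ((cL * rate) ^+ 2 * (cD * rate) ^+ 2) by ring.
  rewrite ler_wpM2l ?mulr_ge0 ?(ltW cK0) ?(ltW l0)//.
  by rewrite ler_pM// ?lerXn2r ?nnegrE ?mulr_ge0 ?(ltW cL0) ?(ltW cD0).
rewrite [leRHS]mulrDl; apply: lerD.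
  rewrite -mulrA ler_wpM2l// (le_trans (y := k * (l / n%:R)))//.
    by rewrite mulrA -[leLHS]mul1r ler_wpM2r// invr_ge0 ltW.
  by rewrite ler_wpM2l// ltW.
rewrite -rate4 -/l invf_div [leLHS]mulrA.
have -> : 4 * M * cK * (cL * cD) ^+ 2 * (rate ^+ 4 * (l / n%:R)) =
   2 * (2 * cK * ((cL * cD) ^+ 2 * (rate ^+ 4 * l))) * M / n%:R by ring.
by rewrite ler_wpM2r ?invr_ge0 ?(ltW n0)// ler_wpM2r ?(ltW M0)// ler_wpM2l.
Qed.
End rates.

Theorem theorem2 (R : realType) (d : nat) (hd : (0 < d)%N)
    (beta : R) (hbeta : 0 < beta)
    (cL cL' cD cD' : R) (hcL : 0 < cL) (hcL' : 0 < cL')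
    (hcD : 0 < cD) (hcD' : 0 < cD')
    (B C K : R) (hB : 1 <= B) (hC : 1 <= C) (hK : 0 < K) :
  exists2 H : R, 0 < H &
  forall (n : nat) (hn : (1 < n)%N) (L D : nat) (hL : (2 < L)%N) (hD : (d <= D)%N),
  let rate := (n%:R / ln n%:R) `^ (d%:R / (4 * (beta + d%:R))) in
  let psi := (ln n%:R / n%:R) `^ (beta / (beta + d%:R)) in
  let lambda : R := n%:R / Num.max (2 * K) C in
  asymp_between cL cL' L%:R rate ->
  asymp_between cD cD' D%:R rate ->
  forall (phi : R -> R)
    (dW : measure_display) (W : measurableType dW) (P : probability W R)
    (Y : 'I_n -> W -> R) (X : 'I_n -> W -> d.-tuple R) (f0 : d.-tuple R -> R)
    (pi : probability (param R d L D) R)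
    (rho : W -> probability (param R d L D) R),
  let Theta := bounded_params R d L D B in
  let f (theta : param R d L D) := network (ltnW (ltnW hL)) phi theta in
  let risk_of (g : d.-tuple R -> R) := risk P Y X (ltnW hn) g in
  logistic_sample P Y X f0 ->
  (forall x y, `|phi x - phi y| <= `|x - y|) ->
  (forall x, `|phi x| <= `|x|) ->
  (sup_norm f0 <= C%:E)%E ->
  (forall theta, theta \in Theta -> (sup_norm (f theta) <= C%:E)%E) ->
  (forall i theta, theta \in Theta ->
    ('E_P[fun w => ((loss (Y i w) (f theta (X i w))
                     - loss (Y i w) (f0 (X i w))) ^+ 2)%R]
     <= K%:E * (risk_of (f theta) - risk_of f0))%E) ->
  standard_gaussian_prior pi ->
  (forall w, gibbs_posterior pi Theta lambda
     (fun theta => empirical_risk Y X w (f theta)) (rho w)) ->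
  (exists2 m : \bar R,
     is_min [set (2%:E * (risk_of (f theta) - risk_of f0))%E | theta in Theta] m &
     (\int[P]_w \int[rho w]_(theta in Theta) risk_of (f theta) - risk_of f0
      <= m + (H * psi)%R%:E)%E) /\
  (forall delta : R, 0 < delta < 1 ->
   exists2 m : \bar R,
     is_min [set (3%:E * (risk_of (f theta) - risk_of f0))%E | theta in Theta] m &
     (P [set w | \int[rho w]_(theta in Theta) risk_of (f theta) - risk_of f0
                 <= m + (H * psi)%R%:E + (H * (ln (2 / delta) / n%:R))%R%:E]
      >= (1 - delta)%R%:E)%E).
Proof.
have p0 := normal_pdf_gt0 B.
have M0 : 0 < Num.max (2 * K) C by rewrite lt_max (lt_le_trans ltr01 hC) orbT.
have [H0 H00 hH] := complexity_le_rate hd hbeta hcL' hcD' hB p0 M0.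
(* H0 pays for the slack and the complexity, the second argument for the
   deviation term 4 ln(2/delta) / lambda. *)
exists (Num.max H0 (4 * Num.max (2 * K) C)); first by rewrite lt_max H00.
set H := Num.max H0 _.
move=> n hn L D hL hD rate psi lambda [_ hLr] [_ hDr] phi dW W P Y X f0 pi rho Theta f risk_of.
move=> sample phi_lip phi_le f0C fC bernstein prior gibbs.
have hL0 : (0 < L)%N := ltnW (ltnW hL).
pose M := Num.max (2 * K) C.
have n0 : 0 < n%:R :> R by rewrite ltr0n ltnW.
have t0 : 0 < M^-1 by rewrite invr_gt0.
have tC : M^-1 * C <= 1 by rewrite mulrC ler_pdivrMr// mul1r le_max lexx orbT.
have tK : M^-1 * K <= 2^-1.
  rewrite mulrC ler_pdivrMr//.
  have : 2 * K <= M by rewrite le_max lexx.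
  lra.
have lamE : lambda = M^-1 * n%:R by rewrite /lambda mulrC.
pose Lambda : R := L%:R * (B * (D%:R + 1)) ^+ L.
have D0 : 0 <= D%:R :> R by [].
have q1 : 1 <= (B * (D%:R + 1)) ^+ L.
  by rewrite exprn_ege1// -[leLHS]mul1r ler_pM// lerDr.
have Lam1 : 1 <= Lambda by rewrite -[leLHS]mul1r ler_pM// ler1n.
pose eps := (n%:R * Lambda)^-1.
have nL1 : 1 <= n%:R * Lambda.
  by rewrite -[leLHS]mul1r ler_pM// ler1n ltnW.
have e01 : 0 < eps <= 1.
  by rewrite invr_gt0 (lt_le_trans ltr01 nL1)/= invf_le1// (lt_le_trans ltr01 nL1).
have slackE : eps * Lambda = n%:R^-1.
  by rewrite /eps invfM -mulrA mulVf ?mulr1// gt_eqF// (lt_le_trans ltr01 Lam1).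
have [theta0 ht0 min0] := exists_risk_minimizer (ltnW hn) hd hD hB hC sample
  phi_lip phi_le f0C fC.
have bound := hH n L D hn hL0 hD hLr hDr.
rewrite -/psi -/Lambda -/eps -slackE in bound.
have psi0 : 0 <= psi by exact: powR_ge0.
have bound' : 2 * (eps * Lambda) + 2 * (#|coef d L D|%:R * - ln (eps * normal_pdf 0 1 B)) / lambda <= H * psi.
  by rewrite (le_trans bound)// ler_wpM2r// le_max lexx.
have fin_risk theta (ht : theta \in Theta) :=
  risk_network (ltnW hn) sample phi_lip fC ht.
have fin_f0 := risk_f0 (ltnW hn) sample f0C.
have gap theta : theta \in Theta -> (risk_of (f theta) - risk_of f0)%E =
    (excess P (Ordinal (ltnW hn)) (observation Y X)
      (excess_loss (ltnW (ltnW hL)) phi f0 B) theta)%:E.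
  move=> ht; rewrite (excessE (ltnW hn) sample phi_lip f0C fC ht) EFinB.
  by congr (_ - _)%E; [exact: fin_risk|exact: fin_f0].
have min_is (a : R) : 0 <= a ->
    is_min [set (a%:E * (risk_of (f theta) - risk_of f0))%E | theta in Theta]
      (a%:E * (risk_of (f theta0) - risk_of f0))%E.
  move=> a0; split; first by exists theta0 => //; exact/set_mem.
  move=> _ [theta /mem_set ht <-].
  rewrite (gap _ ht) (gap _ ht0).
  have m0 := min0 theta ht.
  rewrite -[leLHS]EFinM -[leRHS]EFinM.
  rewrite lee_fin.
  exact: (ler_wpM2l a0 m0).
split.
  exists (2%:E * (risk_of (f theta0) - risk_of f0))%E; first exact: min_is.
  have h := gibbs_risk_expectation hd hD hB hC hK sample phi_lip phi_le
    f0C fC t0 tC tK lamE bernstein prior gibbs ht0 e01.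
  apply: (le_trans h).
  by apply: leeD2l; rewrite lee_fin.
move=> delta hdelta; exists (3%:E * (risk_of (f theta0) - risk_of f0))%E.
  exact: min_is.
apply: (gibbs_risk_probability hd hD hB hC hK sample phi_lip phi_le
  f0C fC t0 tC tK lamE bernstein prior gibbs ht0 e01 hdelta) => //.
have -> : 4 * ln (2 / delta) / lambda = 4 * M * (ln (2 / delta) / n%:R).
  by rewrite /lambda invf_div -/M; ring.
rewrite ler_wpM2r ?le_max ?lexx ?orbT// divr_ge0// ln_ge0//.
have /andP[d0 d1] := hdelta.
by rewrite ler_pdivlMr// mul1r (le_trans (ltW d1))// ler1n.
Qed.
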